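(* Let $k\geq 2$, $q\ge1$ be integers, $\mathcal{A}$ as in the context, and for an integer $m\ge2$ and $0\le a\le m-1$ put $\overline{R}_{n,k}(a;m)=\frac1n\sum_{1\le i\le n,\ i\equiv a\pmod m}X_iX_{i+1}$ for the type-$\mathcal{A}$ random walk on $\mathbb{Z}^k$. Then for every integer $r\ge1$ and all $0\le a\le 2^r-1$, almost surely $$\lim_{n\to\infty}\overline{R}_{n,k}(a;2^r)=\frac{1}{2^r}\prod_p\Big(1-\frac{2}{p^k}\Big),$$ and for every prime $p_1\ge3$ and $0\le a\le p_1-1$, almost surely $$\lim_{n\to\infty}\overline{R}_{n,k}(a;p_1)=\begin{cases}\dfrac{p_1^{k-1}-1}{p_1^k-2}\displaystyle\prod_p\Big(1-\frac{2}{p^k}\Big), & a=0\text{ or }a=p_1-1,\\[2mm] \dfrac{p_1^{k-1}}{p_1^k-2}\displaystyle\prod_p\Big(1-\frac{2}{p^k}\Big), & \text{otherwise},\end{cases}$$ where $p$ runs over all primes.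
   Context: $\mathcal{A}=\{\boldsymbol{\alpha}_1,\dots,\boldsymbol{\alpha}_q\}$ is a finite set of vectors $\boldsymbol{\alpha}_t=(\alpha_{t,1},\dots,\alpha_{t,k})$ with $0<\alpha_{t,j}<1$ for all $j$ and $\alpha_{t,1}+\cdots+\alpha_{t,k}=1$. For $\boldsymbol{\alpha}=(\alpha_1,\dots,\alpha_k)$ of this form, a type-$\boldsymbol{\alpha}$ step $\mathbf{w}(\boldsymbol{\alpha})$ is a random vector equal to the $j$-th standard basis vector of $\mathbb{Z}^k$ with probability $\alpha_j$. The type-$\mathcal{A}$ random walk is $\mathbf{p}_0=(0,\dots,0)$, $\mathbf{p}_i=\mathbf{p}_{i-1}+\mathbf{w}(\boldsymbol{\alpha}'_i)$ for $i\ge1$, where at each step a type $\boldsymbol{\alpha}'_i\in\mathcal{A}$ is chosen and the steps are independent. A lattice point $\mathbf{n}=(n_1,\dots,n_k)\in\mathbb{Z}^k$ is visible if there is no other lattice point on the segment joining it to the origin (equivalently $\gcd(n_1,\dots,n_k)=1$). $X_i=1$ if $\mathbf{p}_i$ is visible and $X_i=0$ otherwise. *)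

(* Defs.v *)
From HB Require Import structures.
From mathcomp Require Import all_boot all_order all_algebra.
From mathcomp Require Import all_classical all_reals all_analysis.
Set Implicit Arguments. Unset Strict Implicit. Unset Printing Implicit Defensive.
Import Order.TTheory GRing.Theory Num.Theory.
Import numFieldNormedType.Exports.
Local Open Scope classical_set_scope.
Local Open Scope ring_scope.

(* Position of the walk after i steps, step t+1 being given by the direction
   w t : 'I_k (the (t+1)-th step is the standard basis vector e_{w t}).
   Coordinates are natural numbers: the j-th coordinate of p_i is the number
   of steps among the first i that went in direction j. *)
Definition walk_pos (k : nat) (w : nat -> 'I_k) (i : nat) : 'I_k -> nat :=
  fun j => count (fun t => w t == j) (iota 0 i).

Definition visible (k : nat) (n : 'I_k -> nat) : bool :=
  (\big[gcdn/0%N]_(j < k) n j) == 1%N.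

Definition Xvis (R : realType) (k : nat) (w : nat -> 'I_k) (i : nat) : R :=
  (visible (walk_pos w i))%:R.

Definition Rbar (R : realType) (k : nat) (w : nat -> 'I_k) (m a n : nat) : R :=
  n%:R^-1 * \sum_(1 <= i < n.+1 | (i %% m == a %% m)%N) (Xvis R w i * Xvis R w i.+1).

Definition prime_prod (R : realType) (k : nat) : R :=
  limn (fun N : nat => \prod_(p < N | prime p) (1 - 2 / (p%:R ^+ k)) : R).

Definition indep_steps (d : measure_display) (T : measurableType d)
  (R : realType) (P : probability T R) (k : nat) (W : nat -> T -> 'I_k) : Prop :=
  forall (s : seq nat) (v : nat -> 'I_k), uniq s ->
    P (\big[setI/setT]_(t <- s) [set x | W t x = v t]) =
    (\prod_(t <- s) P [set x | W t x = v t])%E.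

(* Main.v *)
(** The indicator [X_i X_(i+1)] is compared with its conditional expectation given
    the first [i - L] steps. The differences are orthogonal as soon as the indices are
    more than [L] apart, so Chebyshev's inequality and Borel-Cantelli along
    [n = L ^ 2 = (N + 1) ^ 4], followed by monotone interpolation, reduce the theorem
    to a deterministic statement: the conditional expectations have the right average
    uniformly over the past.

    Modulo a fixed integer [Q], two independent copies of the walk started in the same
    hyperplane [sum = s mod Q] meet with positive probability, so the walk equidistributes
    in the hyperplane; averaging over the time is then averaging over (Z/Q)^k, where the
    Chinese remainder theorem computes the density truncated to the primes below [y].

    The primes [p >= y] are negligible: [p] divides the position at time [i] only if
    [p] divides [i], and then with probability at most a negative power of [min(p, L)],
    because a discrete Nash inequality makes the energy of the law of one coordinate
    decay; for [p > L] at most one prime divides a given [i <= L ^ 2]. *)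
Require Import Defs.
From HB Require Import structures.
From mathcomp Require Import all_boot all_order all_algebra.
From mathcomp Require Import perm.
From mathcomp Require Import all_classical all_reals all_analysis.
From mathcomp Require Import zify ring lra.
Import Order.TTheory GRing.Theory Num.Theory.
Import numFieldNormedType.Exports.
Local Open Scope ring_scope.

(** * Expectation over finitely many steps *)

(** The obstacle is divisibility by large primes. Requiring [p] to divide the time costs a factor
    1/p, and the sum of 1/p diverges. Any further power saving is enough, so the crude rate p^(-1/6)
    for one coordinate replaces a local limit theorem, and the sum may even run over all integers d
    >= y.

    The types form an arbitrary sequence, so nothing is stationary: every estimate uses only a
    common lower bound [dl] of the step probabilities and is uniform in the starting time.

    The scales fit together: the variance of the average is at most 3/L, so L = (N + 1)^2 makes it
    summable, while n = L^2 makes the first [L] indices negligible. Fourth powers still have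
    consecutive ratios tending to 1, as interpolation requires. The level [y] and the modulus [Q]
    are fixed before [L] grows, so the mixing rate may depend on [Q] in any way. *)

Lemma window_count (n i L : nat) :
  (\sum_(j < n) ((i <= j + L) && (j <= i + L)) <= 2 * L + 1)%N.
Proof.
have h : (\sum_(j < n) ((i <= j + L) && (j <= i + L)) <=
          minn n (i + L).+1 - (i - L))%N; last by apply: leq_trans h _; lia.
elim: n => [|n IH]; first by rewrite big_ord0.
rewrite big_ord_recr /=; apply: leq_trans (leq_add IH (leqnn _)) _.
case: (leqP i (n + L)) => h1; case: (leqP n (i + L)) => h2 /=; lia.
Qed.

Section FiniteExpectation.
Context {R : realFieldType} {k : nat} (A : nat -> 'I_k -> R).

(* Expectation of g over the directions taken at times t, ..., t + m - 1. *)
Fixpoint Ex (t m : nat) (g : seq 'I_k -> R) : R :=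
  if m is m'.+1 then \sum_j A t j * Ex t.+1 m' (fun s => g (j :: s)) else g [::].

Lemma eq_Ex t m g h : (forall s, size s = m -> g s = h s) -> Ex t m g = Ex t m h.
Proof.
elim: m t g h => [|m IH] t g h gh /=; first exact: gh.
by apply: eq_bigr => j _; congr (_ * _); apply: IH => s sm; apply: gh; rewrite /= sm.
Qed.

Lemma Ex_lin t m a g h : Ex t m (fun s => a * g s + h s) = a * Ex t m g + Ex t m h.
Proof.
elim: m t g h => [|m IH] t g h //=.
rewrite mulr_sumr -big_split /=; apply: eq_bigr => j _.
by rewrite IH mulrDr mulrCA.
Qed.

Lemma Ex0 t m : Ex t m (fun=> 0) = 0.
Proof. by elim: m t => //= m IH t; rewrite big1 // => j _; rewrite IH mulr0. Qed.

Lemma ExZ t m a g : Ex t m (fun s => a * g s) = a * Ex t m g.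
Proof.
rewrite -[RHS]addr0 -[X in _ + X](Ex0 t m) -Ex_lin.
by apply: eq_Ex => s _; rewrite addr0.
Qed.

Lemma ExZr t m a g : Ex t m (fun s => g s * a) = Ex t m g * a.
Proof. by rewrite mulrC -ExZ; apply: eq_Ex => s _; rewrite mulrC. Qed.

Lemma ExD t m g h : Ex t m (fun s => g s + h s) = Ex t m g + Ex t m h.
Proof.
by rewrite -[in RHS](mul1r (Ex t m g)) -Ex_lin; apply: eq_Ex => s _; rewrite mul1r.
Qed.

Lemma ExN t m g : Ex t m (fun s => - g s) = - Ex t m g.
Proof. by rewrite -mulN1r -ExZ; apply: eq_Ex => s _; rewrite mulN1r. Qed.

Lemma ExB t m g h : Ex t m (fun s => g s - h s) = Ex t m g - Ex t m h.
Proof. by rewrite ExD ExN. Qed.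

Lemma Ex_sum (I : Type) (r : seq I) (p : pred I) t m (g : I -> seq 'I_k -> R) :
  Ex t m (fun s => \sum_(i <- r | p i) g i s) = \sum_(i <- r | p i) Ex t m (g i).
Proof.
elim: r => [|i r IH].
  by rewrite big_nil -[RHS](Ex0 t m); apply: eq_Ex => s _; rewrite big_nil.
rewrite big_cons -IH; case: ifP => pi; last first.
  by apply: eq_Ex => s _; rewrite big_cons pi.
by rewrite -ExD; apply: eq_Ex => s _; rewrite big_cons pi.
Qed.

Lemma Ex_cat t m n g :
  Ex t (m + n) g = Ex t m (fun u => Ex (t + m) n (fun v => g (u ++ v))).
Proof.
elim: m t g => [|m IH] t g /=; first by rewrite addn0.
by apply: eq_bigr => j _; rewrite IH addnS addSn.
Qed.

Hypothesis A_ge0 : forall t j, 0 <= A t j.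
Hypothesis A_sum1 : forall t, \sum_j A t j = 1.

Lemma le_Ex t m g h : (forall s, size s = m -> g s <= h s) -> Ex t m g <= Ex t m h.
Proof.
elim: m t g h => [|m IH] t g h gh /=; first exact: gh.
apply: ler_sum => j _; apply: ler_wpM2l => //.
by apply: IH => s sm; apply: gh; rewrite /= sm.
Qed.

Lemma Ex_cst t m a : Ex t m (fun=> a) = a.
Proof.
elim: m t => //= m IH t; under eq_bigr do rewrite IH.
by rewrite -mulr_suml A_sum1 mul1r.
Qed.

Lemma Ex_take n m g : (m <= n)%N -> Ex 0 n (fun s => g (take m s)) = Ex 0 m g.
Proof.
move=> mn; rewrite -(subnKC mn) Ex_cat; apply: eq_Ex => u um.
rewrite -[RHS](Ex_cst (0 + m) (n - m)); apply: eq_Ex => v _.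
by rewrite take_size_cat.
Qed.

Lemma Ex_ge0 t m g : (forall s, size s = m -> 0 <= g s) -> 0 <= Ex t m g.
Proof. by move=> g0; rewrite -(Ex_cst t m 0); apply: le_Ex. Qed.

Lemma Ex_le1 t m g : (forall s, size s = m -> g s <= 1) -> Ex t m g <= 1.
Proof. by move=> g0; rewrite -(Ex_cst t m 1); apply: le_Ex. Qed.

(* Conditional expectation of [y], a function of [n] steps, given the first
   [size u] steps [u]. *)
Definition condEx n (y : seq 'I_k -> R) (u : seq 'I_k) : R :=
  Ex (size u) (n - size u) (fun v => y (u ++ v)).

(** * Variance of sums of centred terms *)

Section Variance.
Variables (L : nat) (y : nat -> seq 'I_k -> R).
Hypothesis y01 : forall i s, 0 <= y i s <= 1.

(** The inner [take i.+1] makes the term depend on [i.+1] steps only. For [i <= L] the truncated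
    subtraction leaves an empty past, so the centring is by a full expectation. *)
Definition innov (i : nat) (s : seq 'I_k) : R :=
  y i (take i.+1 s) - condEx i.+1 (y i) (take (i - L) s).

Lemma norm_innov i s : `|innov i s| <= 1.
Proof.
have /andP[y0 y1] := y01 i (take i.+1 s).
have c0 : 0 <= condEx i.+1 (y i) (take (i - L) s).
  by apply: Ex_ge0 => v _; have /andP[] := y01 i (take (i - L) s ++ v).
have c1 : condEx i.+1 (y i) (take (i - L) s) <= 1.
  by apply: Ex_le1 => v _; have /andP[] := y01 i (take (i - L) s ++ v).
by rewrite /innov ler_norml; apply/andP; split; lra.
Qed.

(** Given the first [j - L] steps, [innov i] is determined, as it uses only [i.+1 <= j - L] of them,
    and [innov j] has conditional mean zero. *)
Lemma innov_orthogonal n i j : (j < n)%N -> (i < j - L)%N ->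
  Ex 0 n (fun s => innov i s * innov j s) = 0.
Proof.
move=> jn iL.
pose h s := innov i s * innov j s; rewrite -/h.
have -> : h = (fun s => h (take j.+1 s)).
  by apply: funext => s; rewrite /h /innov !take_takel //; lia.
rewrite Ex_take // {}/h.
have jE : j.+1 = ((j - L) + (j.+1 - (j - L)))%N by lia.
rewrite {1}jE Ex_cat -[RHS](Ex_cst 0 (j - L) 0); apply: eq_Ex => u su.
rewrite (@eq_Ex _ _ _ (fun v => innov i u * (y j (u ++ v) - condEx j.+1 (y j) u))); last first.
  move=> v sv; rewrite /innov; congr (_ * (_ - _)).
  - rewrite !takel_cat ?su //; lia.
  - by rewrite take_oversize // size_cat su sv; lia.
  - by rewrite take_size_cat.
by rewrite ExZ ExB Ex_cst /condEx su add0n subrr mulr0.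
Qed.

(** In the expanded square, pairs at distance more than [L] contribute 0 and all others at most 1;
    each index has at most 2L + 1 partners. *)
Lemma innov_variance n :
  Ex 0 n (fun s => (\sum_(i < n) innov i s) ^+ 2) <= (n * (2 * L + 1))%:R.
Proof.
have -> : (fun s => (\sum_(i < n) innov i s) ^+ 2) =
  (fun s => \sum_(i < n) \sum_(j < n) innov i s * innov j s).
  apply: funext => s; rewrite expr2 mulr_suml.
  by apply: eq_bigr => i _; rewrite mulr_sumr.
rewrite Ex_sum natrM -[n in n%:R]card_ord mulr_natl -sumr_const.
apply: ler_sum => i _; rewrite Ex_sum.
apply: (@le_trans _ _ (\sum_(j < n) ((i <= j + L)%N && (j <= i + L)%N)%:R)).
  apply: ler_sum => j _; case: (leqP i (j + L)) => h1; last first.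
    have -> : (fun s => innov i s * innov j s) = (fun s => innov j s * innov i s).
      by apply: funext => s; rewrite mulrC.
    by rewrite innov_orthogonal //; lia.
  case: (leqP j (i + L)) => h2 /=; last by rewrite innov_orthogonal //; lia.
  apply: Ex_le1 => s _; apply: le_trans (ler_norm _) _.
  by rewrite normrM mulr_ile1 // norm_innov.
by rewrite -natr_sum ler_nat window_count.
Qed.

End Variance.
End FiniteExpectation.

(** * Anticoncentration of one coordinate *)

Section Nash.
Context {R : realFieldType}.
Implicit Types (v : nat -> R) (a b : nat -> R).

Lemma cauchy_schwarz_sum n a b :
  (\sum_(i < n) a i * b i) ^+ 2 <= (\sum_(i < n) a i ^+ 2) * (\sum_(i < n) b i ^+ 2).
Proof.
rewrite -subr_ge0.
suff -> : (\sum_(i < n) a i ^+ 2) * (\sum_(i < n) b i ^+ 2) - (\sum_(i < n) a i * b i) ^+ 2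
  = 2^-1 * \sum_(i < n) \sum_(j < n) (a i * b j - a j * b i) ^+ 2.
  by rewrite mulr_ge0 ?invr_ge0 // sumr_ge0 // => i _; rewrite sumr_ge0 // => j _; apply: sqr_ge0.
have -> : \sum_(i < n) \sum_(j < n) (a i * b j - a j * b i) ^+ 2 =
  \sum_(i < n) \sum_(j < n) (a i ^+ 2 * b j ^+ 2) +
  \sum_(i < n) \sum_(j < n) (b i ^+ 2 * a j ^+ 2) -
  2 * \sum_(i < n) \sum_(j < n) (a i * b i) * (a j * b j).
  rewrite mulr_sumr -big_split -sumrB /=; apply: eq_bigr => i _.
  rewrite mulr_sumr -big_split -sumrB /=; apply: eq_bigr => j _; ring.
have E (x y : nat -> R) : \sum_(i < n) \sum_(j < n) (x i * y j) = (\sum_(i < n) x i) * (\sum_(j < n) y j).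
  by rewrite mulr_suml; apply: eq_bigr => i _; rewrite mulr_sumr.
rewrite (E (fun i => a i ^+ 2) (fun i => b i ^+ 2)) (E (fun i => b i ^+ 2) (fun i => a i ^+ 2)).
rewrite (E (fun i => a i * b i) (fun i => a i * b i)).
by field.
Qed.

Definition shift_right v : nat -> R := fun r => if r is r'.+1 then v r' else 0.

Lemma sqr_telescope n v :
  v n ^+ 2 = \sum_(r < n.+1) (v r - shift_right v r) * (v r + shift_right v r).
Proof.
elim: n => [|n IH]; first by rewrite big_ord_recr big_ord0 /=; ring.
by rewrite big_ord_recr /= -IH; ring.
Qed.

Lemma sum_sqr_shift_le n v : \sum_(r < n.+1) (shift_right v r) ^+ 2 <= \sum_(r < n.+1) v r ^+ 2.
Proof. by rewrite big_ord_recl big_ord_recr /= expr0n /= add0r lerDl sqr_ge0. Qed.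

Lemma le_sum_widen (m n : nat) v : (forall i, 0 <= v i) -> (m <= n)%N ->
  \sum_(r < m) v r <= \sum_(r < n) v r.
Proof.
move=> v0 mn; rewrite -(subnKC mn) big_split_ord /= lerDl.
by apply: sumr_ge0.
Qed.

(** Telescoping [v r ^+ 2] and Cauchy-Schwarz give v_r^4 <= 4 G E. The mass is 1, so E is at most
    the maximum of [v]; hence E^4 <= 4 G E, and E cancels. *)
Lemma nash n v : (forall r, 0 <= v r) -> \sum_(r < n) v r = 1 ->
  (\sum_(r < n) v r ^+ 2) ^+ 3 <= 4 * \sum_(r < n) (v r - shift_right v r) ^+ 2.
Proof.
move=> v0 v1.
set E := \sum_(r < n) v r ^+ 2; set G := \sum_(r < n) _.
have E0 : 0 <= E by apply: sumr_ge0 => i _; apply: sqr_ge0.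
have G0 : 0 <= G by apply: sumr_ge0 => i _; apply: sqr_ge0.
have vE (r : nat) : (r < n)%N -> v r ^+ 4 <= 4 * G * E.
  move=> rn; rewrite (_ : v r ^+ 4 = (v r ^+ 2) ^+ 2); last by ring.
  rewrite (sqr_telescope r v).
  apply: le_trans (cauchy_schwarz_sum r.+1 (fun r => v r - shift_right v r)
                       (fun r => v r + shift_right v r)) _.
  rewrite -mulrA mulrCA.
  apply: ler_pM.
  - by apply: sumr_ge0 => i _; apply: sqr_ge0.
  - by apply: sumr_ge0 => i _; apply: sqr_ge0.
  - exact: (le_sum_widen _ _ (fun r => (v r - shift_right v r) ^+ 2) (fun r => sqr_ge0 _)).
  apply: (@le_trans _ _ (2 * \sum_(i < r.+1) v i ^+ 2 + 2 * \sum_(i < r.+1) shift_right v i ^+ 2)).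
    rewrite !mulr_sumr -big_split /=; apply: ler_sum => i _.
    have := sqr_ge0 (v i - shift_right v i); lra.
  have h1 := sum_sqr_shift_le r v.
  have h2 := le_sum_widen _ _ (fun r => (v r) ^+ 2) (fun r => sqr_ge0 _) rn.
  rewrite -/E in h2; lra.
have n0 : (0 < n)%N.
  by case: n v1 {E E0 G G0 vE} => // /eqP; rewrite big_ord0 eq_sym oner_eq0.
have [|EE] := leP E 0.
  move=> h; have -> : E = 0 by apply/eqP; rewrite eq_le h E0.
  by rewrite expr0n /= mulr_ge0.
have E4 : E ^+ 4 <= 4 * G * E.
  pose i0 := Ordinal n0.
  pose r := [arg max_(r > i0) v (nat_of_ord r)]%O.
  have vr (i : 'I_n) : v i <= v (nat_of_ord r).
    rewrite /r; case: (Order.TotalTheory.arg_maxP (fun r : 'I_n => v r)) => // j _ h; exact: h.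
  apply: le_trans (vE r _) => //; rewrite lerXn2r ?nnegrE //.
  rewrite -[leRHS]mul1r -v1 mulr_suml; apply: ler_sum => i _.
  by rewrite expr2 ler_wpM2l.
by rewrite -(ler_pM2r EE) -exprSr.
Qed.

(** This sums ((1 - q)a + qb)^2 = (1 - q)a^2 + qb^2 - q(1 - q)(a - b)^2; [v n = 0] ensures that the
    shift pushes no mass out of the window. *)
Lemma lazy_step_energy n v q : v n = 0 ->
  \sum_(r < n.+1) ((1 - q) * v r + q * shift_right v r) ^+ 2 =
  \sum_(r < n.+1) v r ^+ 2 - q * (1 - q) * \sum_(r < n.+1) (v r - shift_right v r) ^+ 2.
Proof.
move=> vn.
have E : \sum_(r < n.+1) shift_right v r ^+ 2 = \sum_(r < n.+1) v r ^+ 2.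
  by rewrite big_ord_recl big_ord_recr /= vn expr0n /= addr0 add0r.
transitivity ((1 - q) * \sum_(r < n.+1) v r ^+ 2 + q * \sum_(r < n.+1) shift_right v r ^+ 2
   - q * (1 - q) * \sum_(r < n.+1) (v r - shift_right v r) ^+ 2); last by rewrite E; ring.
rewrite !mulr_sumr -big_split -sumrB /=; apply: eq_bigr => i _; ring.
Qed.

End Nash.

Section Anticoncentration.
Context {R : realFieldType} {k : nat} (A : nat -> 'I_k -> R) (dl : R) (j0 j1 : 'I_k).
Hypothesis A_ge0 : forall t j, 0 <= A t j.
Hypothesis A_sum1 : forall t, \sum_j A t j = 1.
Hypothesis dl_gt0 : 0 < dl.
Hypothesis A_ge : forall t j, dl <= A t j.
Hypothesis j01 : j0 != j1.

Definition count_law (t m : nat) (r : nat) : R :=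
  Ex A t m (fun s => (count_mem j0 s == r)%:R).

Lemma count_lawS t m r :
  count_law t m.+1 r = (1 - A t j0) * count_law t.+1 m r
                       + A t j0 * shift_right (count_law t.+1 m) r.
Proof.
rewrite /count_law /= (bigD1 j0) //= addrC; congr (_ + _); last first.
  rewrite eqxx; congr (_ * _); case: r => [|r] /=; last first.
    by apply: eq_Ex.
  by rewrite -[RHS](Ex0 A t.+1 m); apply: eq_Ex.
have -> : 1 - A t j0 = \sum_(j | j != j0) A t j.
  by rewrite -(A_sum1 t) (bigD1 j0) //= addrAC subrr add0r.
by rewrite mulr_suml; apply: eq_bigr => j /negPf jj; rewrite jj.
Qed.

Lemma count_law_ge0 t m r : 0 <= count_law t m r.
Proof. by apply: Ex_ge0. Qed.

Lemma count_law_eq0 t m r : (m < r)%N -> count_law t m r = 0.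
Proof.
move=> mr; rewrite -[RHS](Ex0 A t m); apply: eq_Ex => s sm.
by have := count_size (pred1 j0) s; rewrite sm; case: eqP => // -> ; lia.
Qed.

Lemma count_law_sum1 t m : \sum_(r < m.+1) count_law t m r = 1.
Proof.
rewrite /count_law -Ex_sum -[RHS](Ex_cst A A_sum1 t m); apply: eq_Ex => s sm.
have h : (count_mem j0 s < m.+1)%N by rewrite ltnS -sm count_size.
rewrite (bigD1 (Ordinal h)) //= eqxx big1 ?addr0 // => i.
by rewrite -val_eqE /= eq_sym => /negPf ->.
Qed.

(** The second bound comes from [j1]: a direction other than [j0] has probability at least [dl], so
    the coordinate is genuinely random. *)
Lemma dl_le t : dl <= A t j0 /\ dl <= 1 - A t j0.
Proof.
split; first exact: A_ge.
rewrite -(A_sum1 t) (bigD1 j0) //= addrAC subrr add0r (bigD1 j1) //=; last by rewrite eq_sym.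
by rewrite -[leLHS]addr0 lerD // sumr_ge0.
Qed.

Let energy t m : R := \sum_(r < m.+1) count_law t m r ^+ 2.

(** By [nash], one step lowers the energy E by at least (dl^2/4) E^3. Energies decrease, so each of
    the [m] losses is at least the one computed from the final energy, and the losses total 1 minus
    that energy. Steps are peeled from the front, hence [t] varies in the induction. *)
Lemma energy_decay t m : m%:R * (dl ^+ 2 / 4) * energy t m ^+ 3 + energy t m <= 1.
Proof.
have E0 t' m' : 0 <= energy t' m' by apply: sumr_ge0 => i _; apply: sqr_ge0.
elim: m t => [|m IH] t.
  by rewrite !mul0r add0r /energy big_ord_recr big_ord0 /= /count_law /= expr1n add0r.
have step : energy t m.+1 <= energy t.+1 m - dl ^+ 2 / 4 * energy t.+1 m ^+ 3.
  have v0 := count_law_eq0 t.+1 m m.+1 (ltnSn m).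
  rewrite /energy; under eq_bigr do rewrite count_lawS.
  rewrite (lazy_step_energy _ _ _ v0).
  have -> : \sum_(r < m.+2) count_law t.+1 m r ^+ 2 = \sum_(r < m.+1) count_law t.+1 m r ^+ 2.
    by rewrite big_ord_recr /= v0 expr0n addr0.
  have := nash m.+2 (count_law t.+1 m) (count_law_ge0 t.+1 m).
  rewrite !(big_ord_recr m.+1) /= v0 expr0n !addr0 count_law_sum1 => /(_ erefl).
  set G := (_ + _); rewrite -/(energy t.+1 m) => EG.
  rewrite lerD2l lerN2; have [q1 q2] := dl_le t.
  have G0 : 0 <= G by apply: addr_ge0; [apply: sumr_ge0 => i _|]; apply: sqr_ge0.
  have qq : dl ^+ 2 <= A t j0 * (1 - A t j0) by rewrite expr2 ler_pM // ltW.
  apply: (@le_trans _ _ (dl ^+ 2 * G)); last by rewrite ler_wpM2r.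
  by rewrite -mulrA ler_wpM2l ?sqr_ge0 //; lra.
have c0 : 0 <= dl ^+ 2 / 4 by rewrite divr_ge0 ?sqr_ge0.
have le1 : energy t m.+1 <= energy t.+1 m.
  by apply: le_trans step _; rewrite gerBl mulr_ge0 // exprn_ge0.
have le3 : energy t m.+1 ^+ 3 <= energy t.+1 m ^+ 3 by rewrite lerXn2r // nnegrE.
have := IH t.+1.
have h : m.+1%:R * (dl ^+ 2 / 4) * energy t m.+1 ^+ 3 <= m.+1%:R * (dl ^+ 2 / 4) * energy t.+1 m ^+ 3.
  by rewrite ler_wpM2l // mulr_ge0.
rewrite -natr1 !mulrDl mul1r in h *; lra.
Qed.

Lemma count_law_decay t m r : m%:R * dl ^+ 2 * count_law t m r ^+ 6 <= 4.
Proof.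
have E0 : 0 <= energy t m by apply: sumr_ge0 => i _; apply: sqr_ge0.
have h : count_law t m r ^+ 2 <= energy t m.
  have [rm|rm] := ltnP r m.+1; last by rewrite count_law_eq0 // expr0n.
  by rewrite /energy (bigD1 (Ordinal rm)) //= lerDl sumr_ge0 // => i _; apply: sqr_ge0.
have h3 : count_law t m r ^+ 6 <= energy t m ^+ 3.
  by rewrite -[6%N]/(2 * 3)%N exprM lerXn2r // nnegrE // sqr_ge0.
have := energy_decay t m.
have : m%:R * dl ^+ 2 * count_law t m r ^+ 6 <= m%:R * dl ^+ 2 * energy t m ^+ 3.
  by rewrite ler_wpM2l // mulr_ge0 // sqr_ge0.
lra.
Qed.

(** A root-free substitute for m^(-1/6): since 64 = 2^6, [2 ^+ trunc_log 64 m] is the sixth root of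
    the largest power of 64 not exceeding [m]. The exponent 6 is the cube in [energy_decay] times
    the square in the energy. *)
Definition anti_bound (m : nat) : R := (2 / dl) / 2 ^+ (trunc_log 64 m).

Lemma count_law_le m t r : (0 < m)%N -> count_law t m r <= anti_bound m.
Proof.
move=> m0.
have a0 : 0 <= anti_bound m by rewrite /anti_bound !divr_ge0 // ?exprn_ge0 // ltW.
have dl1 : dl <= 1.
  have [h1 h2] := dl_le t; lra.
rewrite -(@ler_pXn2r _ 6) // ?nnegrE ?count_law_ge0 //.
have md : 0 < m%:R * dl ^+ 2 by rewrite mulr_gt0 ?ltr0n // exprn_gt0.
rewrite -(ler_pM2l md); apply: le_trans (count_law_decay t m r) _.
have [h1 _] := andP (trunc_log_bounds (isT : (1 < 64)%N) m0).
have h2 : (2 ^+ trunc_log 64 m) ^+ 6 <= m%:R :> R.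
  by rewrite exprAC -natrX -natrX ler_nat.
have p0 : 0 < (2 ^+ trunc_log 64 m) ^+ 6 :> R by rewrite exprn_gt0 // exprn_gt0.
rewrite /anti_bound expr_div_n mulrA ler_pdivlMr //.
have h4 : 4 <= dl ^+ 2 * (2 / dl) ^+ 6.
  have -> : dl ^+ 2 * (2 / dl) ^+ 6 = 64 / dl ^+ 4 by field; rewrite gt_eqF.
  rewrite ler_pdivlMr ?exprn_gt0 //.
  have : dl ^+ 4 <= 1 by rewrite exprn_ile1 // ltW.
  lra.
by rewrite mulrC -[leRHS]mulrA ler_pM // ltW.
Qed.

(* A count of m < p steps lies in [0, m], so a congruence mod p pins it to one value. *)
Lemma dvd_count_le (L m p c t : nat) : (0 < m)%N -> (m < p)%N -> (m <= L)%N ->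
  Ex A t L (fun s => (p %| c + count_mem j0 s)%:R) <= anti_bound m.
Proof.
move=> m0 mp mL; rewrite -(subnK mL) Ex_cat -(Ex_cst A A_sum1 t (L - m) (anti_bound m)).
apply: le_Ex => // u _; set c' := (c + count_mem j0 u)%N.
have a0 : 0 <= anti_bound m by rewrite /anti_bound !divr_ge0 // ?exprn_ge0 // ltW.
apply: le_trans (count_law_le _ (t + (L - m)) ((p - c' %% p) %% p)%N m0).
apply: le_Ex => // v sv; rewrite ler_nat count_cat addnA -/c'.
case: (boolP (p %| _)%N) => // /dvdnP[z hz].
have : (count_mem j0 v <= m)%N by rewrite -sv count_size.
move=> hm; suff -> : count_mem j0 v = ((p - c' %% p) %% p)%N by rewrite eqxx.
have p0 : (0 < p)%N by lia.
rewrite -[LHS](@modn_small _ p); last by lia.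
apply/eqP; rewrite -(eqn_modDl c') hz modnMl -modnDml subnKC; first by rewrite modnn.
by rewrite ltnW // ltn_pmod.
Qed.

End Anticoncentration.

(** * Equidistribution modulo Q *)

Section Residues.
Context {k : nat}.
Implicit Types v w : 'I_k -> nat.

Definition vadd v w : 'I_k -> nat := fun i => (v i + w i)%N.
Definition step (j : 'I_k) : 'I_k -> nat := fun i => (j == i : nat).
Definition pos (s : seq 'I_k) : 'I_k -> nat := fun i => count_mem i s.
Definition csum v : nat := (\sum_i v i)%N.
Definition vmod (Q : nat) v w := forall i, v i = w i %[mod Q].

Lemma vaddA u v w : vadd u (vadd v w) = vadd (vadd u v) w.
Proof. by apply: funext => i; rewrite /vadd addnA. Qed.

Lemma pos_cons j s : pos (j :: s) = vadd (step j) (pos s).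
Proof. by apply: funext. Qed.

Lemma pos_cat s s' : pos (s ++ s') = vadd (pos s) (pos s').
Proof. by apply: funext => i; rewrite /pos count_cat. Qed.

Lemma csumD v w : csum (vadd v w) = (csum v + csum w)%N.
Proof. by rewrite /csum -big_split. Qed.

Lemma csum_step j : csum (step j) = 1%N.
Proof. by rewrite /csum (bigD1 j) //= /step eqxx big1 // => i /negPf; rewrite eq_sym => ->. Qed.

Lemma csum_pos s : csum (pos s) = size s.
Proof.
elim: s => [|j s IH]; first by rewrite /csum big1.
by rewrite pos_cons csumD csum_step IH.
Qed.

Lemma modn_sum (I : Type) (r : seq I) (P : pred I) (F G : I -> nat) Q :
  (forall i, P i -> F i = G i %[mod Q]) ->
  (\sum_(i <- r | P i) F i = \sum_(i <- r | P i) G i %[mod Q])%N.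
Proof.
move=> FG; elim/big_rec2: _ => // i m n Pi mn.
by rewrite -modnDm FG // mn modnDm.
Qed.

Lemma vmod_csum Q v w : vmod Q v w -> csum v = csum w %[mod Q].
Proof. by move=> vw; apply: modn_sum. Qed.

Lemma vmodD Q u v w : vmod Q v w -> vmod Q (vadd v u) (vadd w u).
Proof. by move=> vw i; apply/eqP; rewrite eqn_modDr; apply/eqP. Qed.

(* From v and w in the same hyperplane csum = s mod Q, the directions of w from v
   and of v from w, both padded by the direction j0, end at the same residue. *)
Lemma meeting_paths Q v w (j0 : 'I_k) : (0 < Q)%N -> csum v = csum w %[mod Q] ->
  exists s s' : seq 'I_k, [/\ size s = (k * Q)%N, size s' = (k * Q)%N &
    vmod Q (vadd v (pos s)) (vadd w (pos s'))].
Proof.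
move=> Q0 vw.
pose r (u : 'I_k -> nat) := flatten [seq nseq (u i %% Q)%N i | i <- enum 'I_k].
pose p u := r u ++ nseq (k * Q - csum (fun i => u i %% Q)%N) j0.
have posr u : pos (r u) = fun i => (u i %% Q)%N.
  apply: funext => i; rewrite /pos /r count_flatten -map_comp sumnE big_map.
  rewrite big_enum /= (bigD1 i) //= count_nseq /= eqxx mul1n big1 ?addn0 // => l /negPf li.
  by rewrite count_nseq /= li mul0n.
have rle u : (csum (fun i => u i %% Q)%N <= k * Q)%N.
  rewrite -[k in (k * _)%N]card_ord -sum_nat_const; apply: leq_sum => i _.
  by rewrite ltnW // ltn_pmod.
have psize u : size (p u) = (k * Q)%N.
  by rewrite size_cat size_nseq -csum_pos posr subnKC.
exists (p w), (p v); split => // i.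
rewrite /vadd /p !pos_cat /vadd !posr.
have E : (k * Q - csum (fun i => w i %% Q) = k * Q - csum (fun i => v i %% Q) %[mod Q])%N.
  have h u : csum (fun i => u i %% Q)%N = csum u %[mod Q].
    by apply: modn_sum => l _; rewrite modn_mod.
  apply/eqP; rewrite -(eqn_modDr (csum (fun i => w i %% Q)%N)) subnK //.
  by rewrite -modnDmr (h w) -vw -(h v) modnDmr subnK.
rewrite /pos !count_nseq addnA [in RHS]addnA.
rewrite -[LHS]modnDm -[RHS]modnDm.
congr ((_ + _) %% _)%N; first by rewrite !modnDmr addnC.
by rewrite -modnMmr E modnMmr.
Qed.

End Residues.

(** * Averages over (Z/Q)^k *)

Section Average.
Context {R : realFieldType} {k : nat}.
Implicit Types F G : ('I_k -> nat) -> R.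

Definition periodic (Q : nat) F := forall v w, vmod Q v w -> F v = F w.

(* Average of a Q-periodic function over (Z/Q)^k. *)
Definition avg (Q : nat) F : R :=
  (\sum_(v : {ffun 'I_k -> 'I_Q}) F (fun i => v i)) / Q%:R ^+ k.

Definition ind_sum (Q s : nat) (v : 'I_k -> nat) : R := (csum v == s %[mod Q])%:R.

Lemma periodicM Q F G : periodic Q F -> periodic Q G -> periodic Q (fun v => F v * G v).
Proof. by move=> pF pG v w vw; rewrite (pF v w) ?(pG v w). Qed.

Lemma periodic_dvd Q Q' F : (Q %| Q')%N -> periodic Q F -> periodic Q' F.
Proof.
move=> QQ pF v w vw; apply: pF => i.
by rewrite -(modn_dvdm (v i) QQ) vw modn_dvdm.
Qed.

Lemma periodic_ind_sum Q s : periodic Q (ind_sum Q s).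
Proof. by move=> v w /vmod_csum vw; rewrite /ind_sum vw. Qed.

Lemma eq_avg Q F G : F =1 G -> avg Q F = avg Q G.
Proof. by move=> FG; rewrite /avg; congr (_ / _); apply: eq_bigr. Qed.

Lemma avgZ Q a F : avg Q (fun v => a * F v) = a * avg Q F.
Proof. by rewrite /avg -mulr_sumr mulrA. Qed.

Lemma avgB Q F G : avg Q (fun v => F v - G v) = avg Q F - avg Q G.
Proof. by rewrite /avg sumrB mulrBl. Qed.

Lemma avg_sum Q (I : Type) (r : seq I) (P : pred I) (F : I -> ('I_k -> nat) -> R) :
  avg Q (fun v => \sum_(i <- r | P i) F i v) = \sum_(i <- r | P i) avg Q (F i).
Proof. by rewrite /avg exchange_big mulr_suml. Qed.

Lemma avg_cst Q a : (0 < Q)%N -> avg Q (fun=> a) = a.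
Proof.
move=> Q0; rewrite /avg sumr_const card_ffun !card_ord -(mulr_natr a) natrX mulfK //.
by rewrite expf_neq0 // pnatr_eq0 -lt0n.
Qed.

Lemma le_avg Q F G : (forall v, F v <= G v) -> avg Q F <= avg Q G.
Proof.
move=> FG; rewrite /avg ler_wpM2r ?invr_ge0 ?exprn_ge0 //.
by apply: ler_sum.
Qed.

Lemma reindex_avg Q F (phi : ('I_k -> nat) -> 'I_k -> nat) : (0 < Q)%N ->
  periodic Q F -> (forall v w, vmod Q (phi v) (phi w) -> vmod Q v w) ->
  avg Q (fun v => F (phi v)) = avg Q F.
Proof.
move=> Q0 pF phi_inj; rewrite /avg; congr (_ / _).
pose psi (v : {ffun 'I_k -> 'I_Q}) : {ffun 'I_k -> 'I_Q} :=
  [ffun i => Ordinal (ltn_pmod (phi (fun i => v i) i) Q0)].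
have psi_inj : injective psi.
  move=> v w vw; apply/ffunP => i; apply: val_inj.
  rewrite /= -(modn_small (ltn_ord (v i))) -(modn_small (ltn_ord (w i))).
  apply: (phi_inj (fun i => v i) (fun i => w i)) => l.
  by have /ffunP/(_ l) := vw; rewrite !ffunE => /(congr1 val).
rewrite [RHS](reindex_inj psi_inj); apply: eq_bigr => v _.
by apply: pF => i; rewrite ffunE /= modn_mod.
Qed.

Lemma avg_shift Q F u : (0 < Q)%N -> periodic Q F ->
  avg Q (fun v => F (vadd v u)) = avg Q F.
Proof.
move=> Q0 pF; apply: (reindex_avg Q F (fun v => vadd v u)) => // v w vw i.
by have /eqP := vw i; rewrite eqn_modDr => /eqP.
Qed.

Lemma sum_ind_sum Q v : (0 < Q)%N -> \sum_(s < Q) ind_sum Q s v = 1.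
Proof.
move=> Q0; rewrite (bigD1 (Ordinal (ltn_pmod (csum v) Q0))) //= big1 => [|i].
  by rewrite /ind_sum modn_mod eqxx addr0.
by rewrite -val_eqE /= /ind_sum (modn_small (ltn_ord i)) eq_sym => /negPf ->.
Qed.

Lemma avg_sum_ind Q F : (0 < Q)%N ->
  \sum_(s < Q) avg Q (fun v => F v * ind_sum Q s v) = avg Q F.
Proof.
move=> Q0; rewrite -avg_sum; apply: eq_avg => v.
by rewrite -mulr_sumr sum_ind_sum // mulr1.
Qed.

Lemma ind_sum_shift Q s v u : ind_sum Q (s + csum u) (vadd v u) = ind_sum Q s v.
Proof. by rewrite /ind_sum csumD eqn_modDr. Qed.

(** Translation by one basis vector permutes the [Q] hyperplanes cyclically, so they have equal
    density. *)
Lemma avg_ind_sum Q s (j0 : 'I_k) : (0 < Q)%N -> avg Q (ind_sum Q s) = Q%:R^-1.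
Proof.
move=> Q0; have E s' : avg Q (ind_sum Q s') = avg Q (ind_sum Q 0).
  elim: s' => // s' <-; rewrite -(avg_shift _ _ (step j0) Q0 (periodic_ind_sum _ _)).
  apply: eq_avg => v; rewrite -[in RHS](ind_sum_shift Q s' v (step j0)).
  by rewrite csum_step addn1.
have := avg_sum_ind Q (fun=> 1) Q0; rewrite avg_cst //.
under eq_bigr => i _. rewrite (eq_avg _ _ (ind_sum Q i)); last by move=> v; rewrite mul1r.
  rewrite E; over.
rewrite sumr_const card_ord -(mulr_natr (avg _ _)) => h.
have Qn0 : Q%:R != 0 :> R by rewrite pnatr_eq0 -lt0n.
by rewrite (E s) -[LHS](mulfK Qn0) h mul1r.
Qed.

End Average.

(** * Mixing by coupling *)

Section Mixing.
Context {R : realFieldType} {k : nat} (A : nat -> 'I_k -> R) (dl : R) (j0 : 'I_k).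
Hypothesis A_ge0 : forall t j, 0 <= A t j.
Hypothesis A_sum1 : forall t, \sum_j A t j = 1.
Hypothesis dl_gt0 : 0 < dl.
Hypothesis A_ge : forall t j, dl <= A t j.
Implicit Types g : ('I_k -> nat) -> R.

Definition Tr (t m : nat) g (v : 'I_k -> nat) : R := Ex A t m (fun s => g (vadd v (pos s))).

(** Oscillation is measured inside one class of [csum] modulo [Q], because walks started in
    different classes never meet. *)
Definition osc_le (Q : nat) g (om : R) :=
  forall v w, csum v = csum w %[mod Q] -> g v - g w <= om.

Lemma Tr_add t m n g v : Tr t (m + n) g v = Tr t m (Tr (t + m) n g) v.
Proof.
rewrite /Tr Ex_cat; apply: eq_Ex => u _; apply: eq_Ex => s _.
by rewrite pos_cat vaddA.
Qed.

Lemma periodic_Tr Q t m g : periodic Q g -> periodic Q (Tr t m g).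
Proof. by move=> pg v w vw; apply: eq_Ex => s _; apply: pg; apply: vmodD. Qed.

Lemma Tr_sub t m g v w :
  Tr t m g v - Tr t m g w =
  Ex A t m (fun s => Ex A t m (fun s' => g (vadd v (pos s)) - g (vadd w (pos s')))).
Proof.
transitivity (Ex A t m (fun s => g (vadd v (pos s)) - Tr t m g w)).
  by rewrite ExB (Ex_cst A A_sum1).
by apply: eq_Ex => s _; rewrite ExB (Ex_cst A A_sum1).
Qed.

Lemma osc_Tr Q t m g om : osc_le Q g om -> osc_le Q (Tr t m g) om.
Proof.
move=> og v w vw; rewrite Tr_sub -(Ex_cst A A_sum1 t m om).
apply: le_Ex => // s sm; rewrite -(Ex_cst A A_sum1 t m om); apply: le_Ex => // s' sm'.
by apply: og; rewrite !csumD !csum_pos sm sm' -modnDml vw modnDml.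
Qed.

Lemma Ex_point t m s0 : size s0 = m -> dl ^+ m <= Ex A t m (fun s => (s == s0)%:R).
Proof.
elim: m t s0 => [|m IH] t [|j s0] //= [sm].
rewrite (bigD1 j) //= -[leLHS]addr0 exprS lerD //.
  apply: ler_pM => //; [exact: ltW | by rewrite exprn_ge0 // ltW |].
  apply: le_trans (IH t.+1 s0 sm) _; apply: le_Ex => // s _.
  by rewrite eqseq_cons eqxx.
by apply: sumr_ge0 => i _; rewrite mulr_ge0 // Ex_ge0.
Qed.

(** Run two independent copies. Each follows its path from [meeting_paths] with probability at least
    dl^(kQ); if both do, they end at the same residue and the difference of [g] vanishes. Otherwise
    it is at most [om]. *)
Lemma osc_contract Q t g om : (0 < Q)%N -> 0 <= om -> periodic Q g -> osc_le Q g om ->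
  osc_le Q (Tr t (k * Q) g) ((1 - dl ^+ (k * Q) * dl ^+ (k * Q)) * om).
Proof.
move=> Q0 om0 pg og v w vw; set m := (k * Q)%N.
have [s0 [s0' [z1 z2 z3]]] := meeting_paths Q v w j0 Q0 vw.
rewrite Tr_sub.
apply: (@le_trans _ _ (Ex A t m (fun s => Ex A t m (fun s' =>
   om - (om * (s == s0)%:R) * (s' == s0')%:R)))).
  apply: le_Ex => // s sm; apply: le_Ex => // s' sm'.
  case: (s =P s0) => [->|_]; last first.
    rewrite mulr0 mul0r subr0; apply: og.
    by rewrite !csumD !csum_pos sm sm' -modnDml vw modnDml.
  case: (s' =P s0') => [->|_]; first by rewrite (pg _ _ z3) !mulr1 !subrr.
  rewrite mulr0 subr0; apply: og.
  by rewrite !csumD !csum_pos sm' z1 -modnDml vw modnDml.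
under (eq_Ex _ _ _ (fun s => Ex A t m _)) => s _.
  rewrite ExB (Ex_cst A A_sum1) ExZ; over.
rewrite ExB (Ex_cst A A_sum1) ExZr ExZ mulrBl mul1r lerD2l lerN2.
rewrite -[leRHS]mulrA [leLHS]mulrC ler_wpM2l //.
by rewrite ler_pM ?exprn_ge0 ?(ltW dl_gt0) ?Ex_point.
Qed.

Lemma dl_le1 : dl <= 1.
Proof.
rewrite -(A_sum1 0) (bigD1 j0) //= -[leLHS]addr0 lerD //.
by apply: sumr_ge0.
Qed.

Lemma mixing Q l L t g : (0 < Q)%N -> periodic Q g -> osc_le Q g 1 -> (k * Q * l <= L)%N ->
  osc_le Q (Tr t L g) ((1 - dl ^+ (k * Q) * dl ^+ (k * Q)) ^+ l).
Proof.
move=> Q0 pg og; set m := (k * Q)%N.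
have e0 : 0 <= 1 - dl ^+ m * dl ^+ m.
  by rewrite subr_ge0 mulr_ile1 ?exprn_ge0 ?exprn_ile1 ?(ltW dl_gt0) ?dl_le1.
elim: l L t => [|l IH] L t h; first by rewrite expr0; apply: osc_Tr.
have hm : (m <= L)%N by lia.
rewrite -(subnKC hm) => v w vw; rewrite !Tr_add exprS.
apply: osc_contract vw => //; first by rewrite exprn_ge0.
  exact: periodic_Tr.
by apply: IH; lia.
Qed.

Lemma avg_Tr Q t m g : (0 < Q)%N -> periodic Q g -> avg Q (Tr t m g) = avg Q g.
Proof.
move=> Q0 pg; rewrite /avg /Tr -Ex_sum -ExZr -[RHS](Ex_cst A A_sum1 t m).
by apply: eq_Ex => s _; apply: (avg_shift Q g (pos s)).
Qed.

(** A hyperplane has density 1/Q, so the subtracted term is the mean of [g] over the hyperplane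
    reached after [m] steps. By translation invariance it is also the mean of [Tr t m g] over the
    hyperplane of [v], and a value differs from a mean by at most the oscillation. *)
Lemma Tr_near Q t m g om v : (0 < Q)%N -> periodic Q g -> osc_le Q (Tr t m g) om ->
  `|Tr t m g v - Q%:R * avg Q (fun w => g w * ind_sum Q (csum v + m) w)| <= om.
Proof.
move=> Q0 pg og.
have -> : avg Q (fun w => g w * ind_sum Q (csum v + m) w) =
          avg Q (fun w => Tr t m g w * ind_sum Q (csum v) w).
  rewrite -(avg_Tr Q t m) //; last by apply: periodicM => //; apply: periodic_ind_sum.
  apply: eq_avg => w; rewrite /Tr -ExZr; apply: eq_Ex => s sm.
  by rewrite -[in LHS]sm -csum_pos ind_sum_shift.
have Qn0 : Q%:R != 0 :> R by rewrite pnatr_eq0 -lt0n.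
have -> : Tr t m g v = Q%:R * avg Q (fun w : 'I_k -> nat => Tr t m g v * ind_sum Q (csum v) w).
  by rewrite avgZ avg_ind_sum // mulrCA divff // mulr1.
have om_avg : Q%:R * avg Q (fun w : 'I_k -> nat => om * ind_sum Q (csum v) w) = om.
  by rewrite avgZ avg_ind_sum // mulrCA divff // mulr1.
rewrite -mulrBr -avgB -om_avg ler_norml -mulrN !ler_pM2l ?ltr0n //.
rewrite -[X in X <= _]mulN1r -avgZ; apply/andP; split; apply: le_avg => w.
all: rewrite /ind_sum; case: eqP => [vw|_]; rewrite ?mulr0 ?mulr1 ?subrr //.
  by rewrite mulN1r lerNl opprB; apply: og.
by apply: og.
Qed.

End Mixing.

(** * Densities modulo prime powers and the Chinese remainder theorem *)

Section Counting.
Context {R : realFieldType} {k : nat}.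
Implicit Types F G : ('I_k -> nat) -> R.
Implicit Types v w : 'I_k -> nat.

(** The maps [psi1] and [psi2] stay abstract because two bijections are needed: the pair of residues
    for coprime moduli, and remainder with quotient when a modulus is enlarged. *)
Lemma avg_mul (Q1 Q2 : nat) F G (psi1 psi2 : nat -> nat) :
  (forall x, (x < Q1 * Q2)%N -> (psi1 x < Q1)%N /\ (psi2 x < Q2)%N) ->
  (forall x y, (x < Q1 * Q2)%N -> (y < Q1 * Q2)%N ->
     psi1 x = psi1 y -> psi2 x = psi2 y -> x = y) ->
  avg (Q1 * Q2) (fun v => F (psi1 \o v) * G (psi2 \o v)) = avg Q1 F * avg Q2 G.
Proof.
move=> psi_lt psi_inj.
rewrite /avg natrM exprMn mulf_div; congr (_ / _).
pose f1 (v : {ffun 'I_k -> 'I_(Q1 * Q2)}) : {ffun 'I_k -> 'I_Q1} :=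
  [ffun i => Ordinal (psi_lt (v i) (ltn_ord (v i))).1].
pose f2 (v : {ffun 'I_k -> 'I_(Q1 * Q2)}) : {ffun 'I_k -> 'I_Q2} :=
  [ffun i => Ordinal (psi_lt (v i) (ltn_ord (v i))).2].
have f_inj : injective (fun v : {ffun 'I_k -> 'I_(Q1 * Q2)} => (f1 v, f2 v)).
  move=> v w [/ffunP e1 /ffunP e2]; apply/ffunP => i; apply: val_inj.
  have := e1 i; have := e2 i; rewrite !ffunE => /(congr1 val) /= h2 /(congr1 val) /= h1.
  exact: psi_inj.
have f_bij : bijective (fun v : {ffun 'I_k -> 'I_(Q1 * Q2)} => (f1 v, f2 v)).
  by apply: inj_card_bij => //; rewrite card_prod !card_ffun !card_ord expnMn.
rewrite mulr_suml; under [RHS]eq_bigr do rewrite mulr_sumr.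
rewrite pair_bigA /= (reindex _ (onW_bij _ f_bij)) /=.
apply: eq_bigr => v _; congr (F _ * G _); apply: funext => i; by rewrite /= ffunE.
Qed.

Lemma avg_crt (Q1 Q2 : nat) F G : (0 < Q1)%N -> (0 < Q2)%N -> coprime Q1 Q2 ->
  periodic Q1 F -> periodic Q2 G ->
  avg (Q1 * Q2) (fun v => F v * G v) = avg Q1 F * avg Q2 G.
Proof.
move=> Q10 Q20 co pF pG.
rewrite -(avg_mul Q1 Q2 F G (modn^~ Q1) (modn^~ Q2)).
- apply: eq_avg => v; congr (_ * _); [apply: pF | apply: pG] => i /=; by rewrite modn_mod.
- by move=> x _; rewrite !ltn_pmod.
move=> x y hx hy e1 e2; apply/eqP; rewrite -(modn_small hx) -(modn_small hy).
by rewrite chinese_remainder // e1 e2 !eqxx.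
Qed.

Lemma avg_lift (Q n : nat) F : (0 < Q)%N -> (0 < n)%N -> periodic Q F ->
  avg (Q * n) F = avg Q F.
Proof.
move=> Q0 n0 pF; rewrite -[RHS]mulr1 -(avg_cst (k := k) n 1 n0).
rewrite -(avg_mul Q n F (fun=> 1) (modn^~ Q) (divn^~ Q)).
- apply: eq_avg => v; rewrite mulr1; apply: pF => i /=; by rewrite modn_mod.
- by move=> x h; rewrite ltn_pmod // ltn_divLR // mulnC.
by move=> x y _ _ e1 e2; rewrite (divn_eq x Q) (divn_eq y Q) e1 e2.
Qed.

Definition dvdv (d : nat) v : bool := [forall i, (d %| v i)%N].

Definition cop (p : nat) (j : 'I_k) v : R :=
  (~~ dvdv p v && ~~ dvdv p (vadd v (step j)))%:R.

Lemma dvdv_mod Q d v w : (d %| Q)%N -> vmod Q v w -> dvdv d v = dvdv d w.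
Proof.
move=> dQ vw; apply: eq_forallb => i.
by rewrite /dvdn -(modn_dvdm (v i) dQ) vw modn_dvdm.
Qed.

Lemma periodic_dvdv d : periodic d (fun v => (dvdv d v)%:R : R).
Proof. by move=> v w vw; rewrite (dvdv_mod _ _ _ _ (dvdnn d) vw). Qed.

Lemma periodic_cop p j : periodic p (cop p j).
Proof.
move=> v w vw; rewrite /cop (dvdv_mod p p v w) //.
by rewrite (dvdv_mod p p (vadd v (step j)) (vadd w (step j))) //; apply: vmodD.
Qed.

Lemma dvdv_step_excl p j v : (1 < p)%N -> dvdv p v -> ~~ dvdv p (vadd v (step j)).
Proof.
move=> p1 /forallP /(_ j) h; apply/negP => /forallP /(_ j).
by rewrite /vadd /step eqxx dvdn_addr // dvdn1; lia.
Qed.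

(** The two divisibilities exclude each other, as together they would make [p] divide 1. This is the
    source of the 2 in 1 - 2/p^k. *)
Lemma cop_sub p j v : (1 < p)%N ->
  cop p j v = 1 - (dvdv p v)%:R - (dvdv p (vadd v (step j)))%:R.
Proof.
move=> p1; rewrite /cop; case: (boolP (dvdv p v)) => h /=.
  by rewrite (negPf (dvdv_step_excl p j v p1 h)) subr0 subrr.
by rewrite subr0; case: (dvdv p _); rewrite /= ?subrr ?subr0.
Qed.

Lemma avg_dvdv d : (0 < d)%N -> avg d (fun v => (dvdv d v)%:R) = (d%:R ^+ k)^-1 :> R.
Proof.
move=> d0; rewrite /avg (bigD1 [ffun=> Ordinal d0]) //= big1 => [|v].
  have -> : dvdv d (fun i => [ffun=> Ordinal d0] i) by apply/forallP => i; rewrite ffunE /=.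
  by rewrite addr0 mul1r.
case: (boolP (dvdv d _)) => // /forallP h /eqP[]; apply/ffunP => i; rewrite ffunE.
by apply: val_inj => /=; have := h i; rewrite /dvdn modn_small => [/eqP|].
Qed.

Lemma avg_cop p j : (1 < p)%N -> avg p (cop p j) = 1 - 2 / p%:R ^+ k.
Proof.
move=> p1; have p0 : (0 < p)%N by lia.
rewrite (eq_avg _ _ _ (fun v => cop_sub p j v p1)) !avgB avg_cst //.
rewrite (avg_shift p (fun v => (dvdv p v)%:R) (step j)) //; last exact: periodic_dvdv.
rewrite avg_dvdv //; ring.
Qed.

Lemma dvdv_csum d v : dvdv d v -> (d %| csum v)%N.
Proof. by move/forallP => h; apply: dvdn_sum. Qed.

(** If [d] divides [v] it divides [csum v], so on such [v] the indicator of the class [a] is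
    constant, equal to 1 exactly when [d] divides [a]. For v + e_j the class is [a.+1]. Hence the
    exceptional residues 0 and d - 1. *)
Lemma avg_ind_cop d a j : (1 < d)%N ->
  avg d (fun v => ind_sum d a v * cop d j v) =
  d%:R^-1 - ((d %| a)%:R + (d %| a.+1)%:R) / d%:R ^+ k.
Proof.
move=> d1; have d0 : (0 < d)%N by lia.
transitivity (avg d (fun v : 'I_k -> nat => ind_sum d a v - (d %| a)%:R * (dvdv d v)%:R
    - (d %| a.+1)%:R * (dvdv d (vadd v (step j)))%:R) : R).
  apply: eq_avg => v; rewrite cop_sub // !mulrBr mulr1; congr (_ - _ - _).
    rewrite /ind_sum; case: (boolP (dvdv d v)) => h; rewrite ?mulr0 // !mulr1.
    by have := dvdv_csum d v h; rewrite /dvdn => /eqP ->; rewrite eq_sym.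
  rewrite -(ind_sum_shift d a v (step j)) csum_step addn1 /ind_sum.
  case: (boolP (dvdv d _)) => h; rewrite ?mulr0 // !mulr1.
  by have := dvdv_csum d _ h; rewrite /dvdn => /eqP ->; rewrite eq_sym.
rewrite !avgB !avgZ (avg_shift d (fun v => (dvdv d v)%:R) (step j)) //; last exact: periodic_dvdv.
rewrite avg_dvdv // avg_ind_sum //; ring.
Qed.

(* The reflection v |-> - e_j - v and the translation by 2 e_j both preserve [cop 2 j]
   and they act transitively on the residues of csum. *)
Lemma avg_ind_cop2 r a j : (0 < r)%N ->
  avg (2 ^ r) (fun v => ind_sum (2 ^ r) a v * cop 2 j v) =
  (2 ^ r)%:R^-1 * (1 - 2 / 2 ^+ k).
Proof.
move=> r0; set Q := (2 ^ r)%N.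
have Q0 : (0 < Q)%N by rewrite expn_gt0.
have dQ : (2 %| Q)%N by rewrite dvdn_exp.
pose K b : R := avg Q (fun v => ind_sum Q b v * cop 2 j v).
have pK b : periodic Q (fun v => ind_sum Q b v * cop 2 j v).
  apply: periodicM; first exact: periodic_ind_sum.
  exact: (periodic_dvd _ _ _ dQ (periodic_cop 2 j)).
have K2 b : K b.+2 = K b.
  rewrite /K -[LHS](avg_shift Q _ (vadd (step j) (step j))) //.
  apply: eq_avg => v; rewrite -[in RHS](ind_sum_shift Q b v (vadd (step j) (step j))).
  rewrite csumD csum_step addn2; congr (_ * _).
  have E u : dvdv 2 (vadd u (vadd (step j) (step j))) = dvdv 2 u.
    apply: eq_forallb => i; rewrite /vadd addnn -muln2 dvdn_addl // dvdn_mull //.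
  by rewrite /cop E; congr (_ (_ && ~~ _))%:R; rewrite -(E (vadd v _)); congr (dvdv _ _);
     apply: funext => i; rewrite /vadd; lia.
have Kr b c : (Q %| (b + c).+1)%N -> K b = K c.
  (* Multiplication by [Q.-1] is negation modulo [Q] carried out in natural numbers; the reflection
     exchanges the two conditions of [cop]. *)
  move=> hbc; pose phi v := fun i => (Q.-1 * vadd v (step j) i)%N.
  have Qphi v i : (Q %| phi v i + vadd v (step j) i)%N.
    by rewrite /phi addnC -mulSn prednK // dvdn_mulr.
  rewrite /K -(reindex_avg Q _ phi Q0 (pK b)); last first.
    move=> v w vw i; have h : (vadd v (step j) i = vadd w (step j) i %[mod Q])%N.
      apply/eqP; rewrite -(eqn_modDl (phi v i)) (eqP (Qphi v i)) -modnDml vw modnDml.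
      by rewrite (eqP (Qphi w i)).
    by move/eqP: h; rewrite eqn_modDr => /eqP.
  apply: eq_avg => v; congr (_ * _).
    rewrite /ind_sum; congr (nat_of_bool _)%:R.
    have h1 : (Q %| csum (phi v) + (csum v).+1)%N.
      rewrite -addn1 -(csum_step j) -!csumD; apply: dvdn_sum => i _; exact: Qphi.
    rewrite -(eqn_modDr (csum v).+1) (eqP h1) -[in RHS](eqn_modDl b.+1).
    by rewrite [in RHS](_ : b.+1 + c = (b + c).+1)%N // (eqP hbc) eq_sym addSnnS.
  have h2 u : dvdv 2 (vadd (phi v) u) = dvdv 2 (vadd (vadd v (step j)) u).
    apply: eq_forallb => i; have := dvdn_trans dQ (Qphi v i); rewrite /vadd.
    by rewrite !dvdn2; lia.
  have h3 : dvdv 2 (phi v) = dvdv 2 (vadd v (step j)).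
    apply: eq_forallb => i; have := dvdn_trans dQ (Qphi v i); rewrite /vadd.
    by rewrite !dvdn2; lia.
  rewrite /cop h2 h3 andbC; congr (_ (~~ _ && _))%:R.
  apply: eq_forallb => i; rewrite /vadd !dvdn2; lia.
have Kd b d : K (b + d.*2)%N = K b by elim: d => [|d IH]; rewrite ?addn0 // doubleS !addnS K2.
have K0 b : K b = K 0%N.
  have [ob|eb] := boolP (odd b); last first.
    by rewrite -[b]odd_double_half (negPf eb) Kd.
  (* An odd class [b] is reflected to the even class -b - 1, represented by (b + 1)(Q - 1) = 2c. *)
  have [c hc] : exists c, (b + c.*2).+1 = (b.+1 * Q)%N.
    exists ((b.+1 * Q - b.+1)./2).
    have h : (2 %| b.+1 * Q - b.+1)%N by rewrite dvdn_sub ?dvdn_mulr ?dvdn_mull // dvdn2 /= ob.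
    have := leq_pmulr b.+1 Q0; rewrite dvdn2 in h; lia.
  rewrite (Kr b c.*2); first by rewrite -[c.*2]add0n Kd.
  by rewrite hc dvdn_mull.
have S : \sum_(s < Q) K s = 1 - 2 / 2 ^+ k.
  rewrite -(avg_cop 2 j) // -(avg_lift 2 (2 ^ r.-1)) ?expn_gt0 //; last exact: periodic_cop.
  rewrite -expnS prednK // -(avg_sum_ind (2 ^ r)%N) //; apply: eq_bigr => s _.
  by apply: eq_avg => v; rewrite mulrC.
have Qn0 : Q%:R != 0 :> R by rewrite pnatr_eq0 -lt0n.
rewrite -/(K a) -S (eq_bigr (fun=> K 0%N)) // sumr_const card_ord K0.
by rewrite -(mulr_natl (K _)) mulrA mulVf // mul1r.
Qed.

(** In the application [m] is a power of [p0], so the condition at [p0] is correlated with the class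
    modulo [m] and is set apart; the other primes are independent of both. *)
Definition trunc_edge (m p0 a y : nat) (j : 'I_k) v : R :=
  ind_sum m a v * cop p0 j v * \prod_(p < y | prime p && (val p != p0)) cop p j v.

Definition modulus (m p0 y : nat) : nat := (m * \prod_(p < y | prime p && (val p != p0)) p)%N.

Lemma prod_ltS (S : comPzSemiRingType) (P : pred nat) (F : nat -> S) y :
  \prod_(p < y.+1 | P p) F p = (\prod_(p < y | P p) F p) * (if P y then F y else 1).
Proof. by rewrite big_mkcond big_ord_recr /= -big_mkcond. Qed.

Lemma prodn_ltS (P : pred nat) (F : nat -> nat) y :
  (\prod_(p < y.+1 | P p) F p = (\prod_(p < y | P p) F p) * (if P y then F y else 1))%N.
Proof. by rewrite big_mkcond big_ord_recr /= -big_mkcond. Qed.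

Lemma truncS m p0 a y j v : trunc_edge m p0 a y.+1 j v =
  trunc_edge m p0 a y j v * (if prime y && (y != p0) then cop y j v else 1).
Proof.
by rewrite /trunc_edge (prod_ltS _ (fun p => prime p && (p != p0)) (fun p => cop p j v)) mulrA.
Qed.

Lemma modulusS m p0 y : modulus m p0 y.+1 =
  (modulus m p0 y * (if prime y && (y != p0) then y else 1))%N.
Proof.
by rewrite /modulus (prodn_ltS (fun p => prime p && (p != p0)) id) mulnA.
Qed.

Lemma modulus_gt0 m p0 y : (0 < m)%N -> (0 < modulus m p0 y)%N.
Proof.
move=> m0; rewrite muln_gt0 m0 prodn_cond_gt0 // => p /andP[pp _].
exact: prime_gt0.
Qed.

Lemma periodic_trunc m p0 a y j : (p0 %| m)%N ->
  periodic (modulus m p0 y) (trunc_edge m p0 a y j).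
Proof.
move=> pm; elim: y => [|y IH].
  rewrite /modulus /trunc_edge big_ord0 muln1 => v w vw; rewrite !big_ord0.
  by rewrite (periodic_ind_sum m a v w vw) (periodic_dvd _ _ _ pm (periodic_cop p0 j) v w vw).
move=> v w; rewrite modulusS !truncS => vw.
rewrite (periodic_dvd _ _ _ (dvdn_mulr _ (dvdnn _)) IH v w vw); congr (_ * _).
case: ifP vw => // _ vw.
by rewrite (periodic_dvd _ _ _ (dvdn_mull _ (dvdnn _)) (periodic_cop y j) v w vw).
Qed.

Lemma coprime_modulus m p0 y p : prime p0 -> (exists e, m = p0 ^ e)%N ->
  prime p -> p != p0 -> (y <= p)%N -> coprime (modulus m p0 y) p.
Proof.
move=> pp0 [e ->] pp pn; elim: y => [|y IH] yp.
  rewrite /modulus big_ord0 muln1 coprime_sym; apply: coprimeXr.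
  by rewrite prime_coprime // dvdn_prime2.
rewrite modulusS coprimeMl IH 1?ltnW //=; case: ifP => [/andP[py _]|_]; last exact: coprime1n.
by rewrite prime_coprime // dvdn_prime2 // neq_ltn yp.
Qed.

Lemma avg_trunc m p0 a y j e : prime p0 -> m = (p0 ^ e.+1)%N ->
  avg (modulus m p0 y) (trunc_edge m p0 a y j) =
  avg m (fun v => ind_sum m a v * cop p0 j v) *
  \prod_(p < y | prime p && (val p != p0)) (1 - 2 / p%:R ^+ k).
Proof.
move=> pp0 mE; have m0 : (0 < m)%N by rewrite mE expn_gt0 prime_gt0.
have pm : (p0 %| m)%N by rewrite mE dvdn_exp.
elim: y => [|y IH].
  rewrite /modulus /trunc_edge !big_ord0 muln1 mulr1; apply: eq_avg => v.
  by rewrite big_ord0 mulr1.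
rewrite modulusS (eq_avg _ _ _ (truncS m p0 a y j)).
rewrite (prod_ltS _ (fun p => prime p && (p != p0)) (fun p => 1 - 2 / p%:R ^+ k)).
case: ifP => [/andP[py yp0]|_]; last first.
  by rewrite muln1 !mulr1 -IH; apply: eq_avg => v; rewrite mulr1.
rewrite avg_crt ?modulus_gt0 ?(prime_gt0 py) //.
- by rewrite IH avg_cop ?prime_gt1 // mulrA.
- by apply: coprime_modulus => //; exists e.+1.
- exact: periodic_trunc.
exact: periodic_cop.
Qed.

(** Transposing two coordinates preserves [csum] and all divisibilities. So the class means do not
    depend on the direction of the next step, and its weights sum out. *)
Lemma avg_trunc_swap m p0 a y j j' Q s : (0 < Q)%N -> periodic Q (trunc_edge m p0 a y j) ->
  avg Q (fun v => trunc_edge m p0 a y j v * ind_sum Q s v) =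
  avg Q (fun v => trunc_edge m p0 a y j' v * ind_sum Q s v).
Proof.
move=> Q0 pt; pose phi v : 'I_k -> nat := v \o tperm j j'.
rewrite -(reindex_avg Q _ phi Q0).
- apply: eq_avg => v.
  have E1 m' b : ind_sum m' b (phi v) = ind_sum m' b v :> R.
    have cE : csum (phi v) = csum v by rewrite /csum [RHS](reindex_inj (@perm_inj _ (tperm j j'))).
    by rewrite /ind_sum cE.
  have E2 d w : dvdv d (phi w) = dvdv d w.
    apply/forallP/forallP => h i; last exact: h.
    by rewrite -(tpermK j j' i); apply: h.
  have E3 p : cop p j (phi v) = cop p j' v.
    rewrite /cop E2; congr (_ (_ && ~~ _))%:R; rewrite -(E2 p (vadd v (step j'))).
    congr (dvdv _ _); apply: funext => i; rewrite /phi /vadd /step /=; congr (_ + _)%N.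
    by rewrite -[in RHS](inj_eq (@perm_inj _ (tperm j j'))) tpermR tpermK.
  rewrite /trunc_edge !E1 E3; congr (_ * _ * _ * _); apply: eq_bigr => p _; exact: E3.
- by apply: periodicM => //; apply: periodic_ind_sum.
move=> v w vw i; have := vw (tperm j j' i).
by rewrite /phi /= tpermK.
Qed.

End Counting.

(** * Truncation to small primes *)

Section Sums.
Context {R : realFieldType}.

Lemma sum_dvdn_succ d n : (0 < d)%N -> (\sum_(i < n) (d %| i.+1) = n %/ d)%N.
Proof.
move=> d0; elim: n => [|n IH]; first by rewrite big_ord0 div0n.
by rewrite big_ord_recr /= IH divnS // addnC.
Qed.

Lemma sum_dvdn d n : (0 < d)%N -> (\sum_(i < n) (d %| i) <= n %/ d + 1)%N.
Proof.
move=> d0; rewrite addnC -sum_dvdn_succ //.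
apply: (@leq_trans (\sum_(i < n.+1) (d %| i))); last by rewrite big_ord_recl dvdn0.
by rewrite big_ord_recr /= leq_addr.
Qed.

Lemma periodic_cesaro (f : nat -> R) Q c n : (0 < Q)%N ->
  (forall i, f (Q + i)%N = f i) -> (forall i, 0 <= f i <= 1) ->
  \sum_(i < Q) f i = Q%:R * c -> `|\sum_(i < n) f i - n%:R * c| <= Q%:R.
Proof.
move=> Q0 fQ f01 fc.
have sb m : 0 <= \sum_(i < m) f i <= m%:R.
  rewrite sumr_ge0 /=; last by move=> i _; have /andP[] := f01 i.
  rewrite -[leRHS](mulr1 _) mulr_natl -[m in leRHS]card_ord -sumr_const; apply: ler_sum => i _.
  by have /andP[] := f01 i.
have Qp : 0 < Q%:R :> R by rewrite ltr0n.
have c01 : 0 <= c <= 1.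
  by have := sb Q; rewrite fc pmulr_rge0 // => /andP[-> h]; rewrite -(ler_pM2l Qp) mulr1.
elim/ltn_ind: n => n IH; have [nQ|Qn] := ltnP n Q.
  have /andP[h1 h2] := sb n; have /andP[h3 h4] := c01.
  have h5 : n%:R <= Q%:R :> R by rewrite ler_nat ltnW.
  have h6 : 0 <= n%:R * c :> R by rewrite mulr_ge0.
  have h7 : n%:R * c <= n%:R :> R by rewrite ler_piMr.
  rewrite ler_norml; apply/andP; split; lra.
rewrite -(subnKC Qn) big_split_ord /= natrD mulrDl fc.
under [X in _ + X - _]eq_bigr do rewrite fQ.
rewrite opprD addrACA subrr add0r; apply: IH; lia.
Qed.

(** The block from 64^c to 64^(c+1) has 63 * 64^c terms, each at most 1/(2^c 64^c). Its sum is at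
    most 63/2^c = 126 (2^(-c) - 2^(-c-1)), which telescopes. *)
Lemma dyadic_tail a b :
  \sum_(64 ^ a <= e < 64 ^ (a + b)) (2 ^+ trunc_log 64 e * e%:R)^-1
    <= 126 * ((2 ^+ a)^-1 - (2 ^+ (a + b))^-1) :> R.
Proof.
elim: b => [|b IH]; first by rewrite addn0 big_geq // subrr mulr0.
have h1 : (64 ^ a <= 64 ^ (a + b))%N by rewrite leq_exp2l // leq_addr.
have h2 : (64 ^ (a + b) <= 64 ^ (a + b).+1)%N by rewrite leq_exp2l.
rewrite addnS (big_cat_nat h1 h2) /=.
set c := (a + b)%N in IH h1 h2 *.
have p2 n : 0 < 2 ^+ n :> R by rewrite exprn_gt0.
have p64 : 0 < 64 ^+ c :> R by rewrite exprn_gt0.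
suff : \sum_(64 ^ c <= e < 64 ^ c.+1) (2 ^+ trunc_log 64 e * e%:R)^-1 <= 63 * (2 ^+ c)^-1 :> R.
  by rewrite exprS invfM; lra.
apply: (@le_trans _ _ (\sum_(64 ^ c <= e < 64 ^ c.+1) (2 ^+ c * 64 ^+ c)^-1)).
  rewrite big_nat_cond [leRHS]big_nat_cond; apply: ler_sum => e /andP[/andP[e1 e2] _].
  rewrite (@trunc_log_eq 64 c) ?e1 ?e2 // lef_pV2 ?posrE ?mulr_gt0 ?ltr0n //.
    by rewrite ler_pM2l // -natrX ler_nat.
  by apply: leq_trans e1; rewrite expn_gt0.
rewrite sumr_const_nat expnS.
have -> : (64 * 64 ^ c - 64 ^ c = 63 * 64 ^ c)%N by lia.
rewrite -(mulr_natl _ (63 * 64 ^ c)) natrM natrX invfM mulrACA divff ?gt_eqF // mulr1 //.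
Qed.

End Sums.

(** * Pointwise comparison with the truncated indicator *)

Section Pointwise.
Context {R : realType} {k : nat}.
Implicit Types v : 'I_k -> nat.

(** Bounding [p] by [csum v] gives a boolean and loses nothing for nonzero [v]. At the origin the
    predicate is false, which is why [trunc_le_edge] asks for positive [csum v]. *)
Definition big_prime_dvd (y : nat) v : bool :=
  [exists p : 'I_(csum v).+1, [&& prime p, (y <= p)%N & dvdv p v]].

Lemma coord_le_csum v i : (v i <= csum v)%N.
Proof. by rewrite /csum (bigD1 i) //= leq_addr. Qed.

Lemma dvd_visible p v : (1 < p)%N -> visible v -> ~~ dvdv p v.
Proof.
move=> p1 /eqP vv; apply/negP => /forallP h.
suff : (p %| 1)%N by rewrite dvdn1; lia.
by rewrite -vv; apply: (big_ind (fun n => p %| n)%N) => // x z px pz; rewrite dvdn_gcd px.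
Qed.

Lemma invisible_prime v : (0 < csum v)%N -> ~~ visible v ->
  exists2 p, prime p & dvdv p v && (p <= csum v)%N.
Proof.
move=> v0 nv; set g := \big[gcdn/0%N]_(j < k) v j.
have gd i : (g %| v i)%N by rewrite /g (bigD1 i) //= dvdn_gcdl.
have [i vi] : exists i, v i != 0%N.
  apply/existsP; apply: contraT; rewrite negb_exists => /forallP h.
  by move: v0; rewrite /csum big1 // => i _; have := h i; rewrite negbK => /eqP.
have g1 : (1 < g)%N.
  have : (0 < g)%N by apply: dvdn_gt0 (gd i); rewrite lt0n.
  by move: nv; rewrite /visible -/g; lia.
exists (pdiv g); first exact: pdiv_prime.
apply/andP; split; first by apply/forallP => l; apply: dvdn_trans (gd l); apply: pdiv_dvd.
apply: leq_trans (coord_le_csum v i); apply: dvdn_leq; first by rewrite lt0n.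
exact: dvdn_trans (pdiv_dvd _) (gd i).
Qed.

Definition edge (m a : nat) (j : 'I_k) v : R :=
  ind_sum m a v * (visible v && visible (vadd v (step j)))%:R.

Lemma edge_le_trunc m p0 a y j v : prime p0 -> edge m a j v <= trunc_edge m p0 a y j v.
Proof.
move=> pp0; rewrite /edge /trunc_edge -mulrA ler_wpM2l //.
case: (boolP (visible v)) => h1; last by rewrite mulr_ge0 // prodr_ge0.
case: (boolP (visible (vadd _ _))) => h2; last by rewrite mulr_ge0 // prodr_ge0.
have E p : prime p -> cop p j v = 1 :> R.
  by move=> pp; rewrite /cop !dvd_visible // prime_gt1.
by rewrite E // mul1r big1 // => p /andP[pp _]; apply: E.
Qed.

Lemma cop_ge0_le1 p j v : 0 <= (cop p j v : R) <= 1.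
Proof. by rewrite /cop ler0n lern1 leq_b1. Qed.

Lemma prod_cop_ge0_le1 (P : pred nat) y j v :
  0 <= \prod_(p < y | P p) (cop p j v : R) <= 1.
Proof.
apply/andP; split; last by apply: prodr_ile1 => p _; exact: cop_ge0_le1.
by apply: prodr_ge0.
Qed.

Lemma trunc_le1 m p0 a y j v : trunc_edge m p0 a y j v <= 1 :> R.
Proof.
have /andP[p1 p2] := prod_cop_ge0_le1 (fun p => prime p && (p != p0)) y j v.
have /andP[c1 c2] := cop_ge0_le1 p0 j v.
have i1 : ind_sum m a v <= 1 :> R by rewrite /ind_sum lern1 leq_b1.
by rewrite /trunc_edge !mulr_ile1 // mulr_ge0.
Qed.

Lemma trunc_ge0 m p0 a y j v : 0 <= trunc_edge m p0 a y j v :> R.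
Proof. by rewrite /trunc_edge !mulr_ge0 // prodr_ge0. Qed.

(** If no prime >= y divides either endpoint, an endpoint that is not visible has a common prime
    factor below [y], which makes the truncated product vanish. *)
Lemma trunc_le_edge m p0 a y j v : prime p0 -> (p0 < y)%N -> (0 < csum v)%N ->
  trunc_edge m p0 a y j v - (big_prime_dvd y v)%:R - (big_prime_dvd y (vadd v (step j)))%:R
  <= edge m a j v.
Proof.
move=> pp0 py v0; have e0 : 0 <= edge m a j v :> R by rewrite mulr_ge0.
have t1 := trunc_le1 m p0 a y j v.
have b0 : 0 <= (big_prime_dvd y (vadd v (step j)))%:R :> R by [].
case: (boolP (big_prime_dvd y v)) => h1 /=.
  by apply: le_trans e0; rewrite subr_le0; apply: le_trans b0; rewrite subr_le0.
rewrite subr0; case: (boolP (big_prime_dvd y _)) => h2 /=.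
  by apply: le_trans e0; rewrite subr_le0.
rewrite subr0 /trunc_edge /edge -mulrA ler_wpM2l //.
have small p : prime p -> (p < y)%N -> cop p j v = 0 :> R ->
    cop p0 j v * \prod_(p < y | prime p && (val p != p0)) cop p j v = 0 :> R.
  move=> pp yp c0; have [E|ne] := eqVneq p p0; first by rewrite -E c0 mul0r.
  by rewrite (bigD1 (Ordinal yp)) ?pp ?ne //= c0 mul0r mulr0.
have cop1 : cop p0 j v * \prod_(p < y | prime p && (val p != p0)) cop p j v <= 1 :> R.
  have /andP[p1 p2] := prod_cop_ge0_le1 (fun p => prime p && (p != p0)) y j v.
  by have /andP[c1 c2] := cop_ge0_le1 p0 j v; rewrite mulr_ile1.
case: (boolP (visible v)) => h3 /=; last first.
  have [p pp /andP[pv pc]] := invisible_prime v v0 h3.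
  have [yp|yp] := ltnP p y; first by rewrite (small p) // /cop pv.
  by case/negP: h1; apply/existsP; exists (inord p); rewrite inordK // pp yp.
case: (boolP (visible (vadd _ _))) => h4 //=.
have [|p pp /andP[pv pc]] := invisible_prime (vadd v (step j)) _ h4.
  by rewrite csumD csum_step addn1.
have [yp|yp] := ltnP p y; first by rewrite (small p) // /cop pv andbF.
by case/negP: h2; apply/existsP; exists (inord p); rewrite inordK // pp yp.
Qed.

End Pointwise.

(** * Conditional means *)

Section ConditionalMean.
Context {R : realType} {k : nat} (A : nat -> 'I_k -> R) (dl : R) (j0 j1 : 'I_k).
Hypothesis A_sum1 : forall t, \sum_j A t j = 1.
Hypothesis dl_gt0 : 0 < dl.
Hypothesis A_ge : forall t j, dl <= A t j.
Hypothesis j01 : j0 != j1.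

Let A_ge0 t j : 0 <= A t j. Proof. exact: le_trans (ltW dl_gt0) (A_ge t j). Qed.

Definition pairvis (m a i : nat) (s : seq 'I_k) : R :=
  ((i == a %[mod m]) && (visible (pos (take i s)) && visible (pos s)))%:R.

Lemma pairvis_edge m a i s j : size s = i ->
  pairvis m a i (s ++ [:: j]) = edge m a j (pos s).
Proof.
move=> si; rewrite /pairvis /edge take_size_cat // /ind_sum csum_pos si pos_cat.
have -> : pos [:: j] = step j by apply: funext => i'; rewrite /pos /step /= addn0.
by rewrite -natrM mulnb.
Qed.

Lemma condEx_pairvis m a i L (u : seq 'I_k) : size u = (i - L)%N -> (L <= i)%N ->
  condEx A i.+1 (pairvis m a i) u =
  Ex A (i - L) L (fun v => \sum_j A i j * edge m a j (vadd (pos u) (pos v))).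
Proof.
move=> su Li; rewrite /condEx su (_ : i.+1 - (i - L) = L + 1)%N; last by lia.
rewrite Ex_cat; apply: eq_Ex => v sv /=; rewrite subnK //.
apply: eq_bigr => j _; rewrite catA pairvis_edge ?pos_cat //.
by rewrite size_cat su sv subnK.
Qed.

(** Bounds the probability that a prime >= y divides the position at time [I]. Up to [L] the union
    is over all divisors [d] of [I], and [d.-1] is the largest number of steps whose count is
    determined by its residue modulo [d]. The last term pays for the one possible prime above
    [L]. *)
Definition small_mass (y L I : nat) : R :=
  \sum_(d < L.+1 | (y <= d)%N && (d %| I)%N) anti_bound dl d.-1 + anti_bound dl L.

Lemma anti_bound_ge0 n : 0 <= anti_bound dl n.
Proof. by rewrite /anti_bound !divr_ge0 ?exprn_ge0 ?(ltW dl_gt0). Qed.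

Lemma Ex_big_le y L t n x : csum x = t -> (0 < L <= n)%N -> (2 <= y)%N ->
  (0 < t + n <= L ^ 2)%N ->
  Ex A t n (fun s => (big_prime_dvd y (vadd x (pos s)))%:R) <= small_mass y L (t + n).
Proof.
move=> xt /andP[L0 Ln] y2 /andP[I0 IL].
pose big := [pred p : 'I_(t + n).+1 | [&& prime p, (L < p)%N & (p %| t + n)%N]].
(* If no prime above [L] divides the time, the default [L.+1] serves equally well: the estimate only
   asks for q > L. *)
pose q := if [pick p | big p] is Some p then nat_of_ord p else L.+1.
have Lq : (L < q)%N by rewrite /q; case: pickP => // p /and3P[].
have uniq_q p : prime p -> (L < p)%N -> (p %| t + n)%N -> p = q.
  move=> pp Lp pd; rewrite /q; case: pickP => [p' /and3P[pp' Lp' pd']|]; last first.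
    have hp : (p < (t + n).+1)%N by rewrite ltnS dvdn_leq.
    by move/(_ (Ordinal hp)); rewrite /= pp Lp pd.
  apply/eqP; apply: contraT => pne.
  have : (p * p' %| t + n)%N by rewrite Gauss_dvd ?pd ?pd' // prime_coprime // dvdn_prime2.
  move/(dvdn_leq I0); have : (L.+1 * L.+1 <= p * p')%N by rewrite leq_mul.
  by nia.
apply: (@le_trans _ _ (Ex A t n (fun s =>
    \sum_(d < L.+1 | (y <= d)%N && (d %| t + n)%N) (d %| x j0 + count_mem j0 s)%:R
    + (q %| x j0 + count_mem j0 s)%:R))).
  apply: le_Ex => // s sn.
  have sum0 : 0 <= \sum_(d < L.+1 | (y <= d)%N && (d %| t + n)%N)
      (d %| x j0 + count_mem j0 s)%:R :> R by apply: sumr_ge0.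
  case: (boolP (big_prime_dvd y _)) => [/existsP[p /and3P[pp yp pd]]|_]; last by rewrite addr_ge0.
  have csE : csum (vadd x (pos s)) = (t + n)%N by rewrite csumD csum_pos xt sn.
  have pI : (p %| t + n)%N by rewrite -csE; exact: dvdv_csum pd.
  have pj : (p %| x j0 + count_mem j0 s)%N by move/forallP : pd => /(_ j0).
  have [pL|Lp] := leqP p L; last first.
    by rewrite -(uniq_q p pp Lp pI) pj lerDr.
  have hp : (p < L.+1)%N by [].
  rewrite (bigD1 (Ordinal hp)) /= ?yp ?pI // pj.
  by rewrite -addrA lerDl addr_ge0 // sumr_ge0.
rewrite ExD Ex_sum /small_mass lerD //; last first.
  exact: (dvd_count_le A dl j0 j1).
apply: ler_sum => d /andP[yd _].
apply: (dvd_count_le A dl j0 j1) => //; have := ltn_ord d; lia.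
Qed.

Section Truncation.
Variables (m p0 a y Q : nat) (om : R) (L : nat).
Hypothesis p0_prime : prime p0.
Hypothesis p0y : (p0 < y)%N.
Hypothesis Q_gt0 : (0 < Q)%N.
Hypothesis per : forall j, periodic Q (trunc_edge m p0 a y j : ('I_k -> nat) -> R).
Hypothesis mix : forall t j, osc_le Q (Tr A t L (trunc_edge m p0 a y j)) om.

(** The mean over the hyperplane of sum [i] modulo [Q]; by [avg_trunc_swap] the direction [j0] can
    stand for any other. *)
Definition class_mean (i : nat) : R :=
  Q%:R * avg Q (fun v => trunc_edge m p0 a y j0 v * ind_sum Q i v).

Lemma Tr_trunc_near i j (u : seq 'I_k) : size u = (i - L)%N -> (L <= i)%N ->
  `|Tr A (i - L) L (trunc_edge m p0 a y j) (pos u) - class_mean i| <= om.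
Proof.
move=> su Li; have := Tr_near A j0 A_sum1 Q (i - L) L _ om (pos u) Q_gt0 (per j) (mix _ j).
by rewrite csum_pos su subnK // (avg_trunc_swap _ _ _ _ _ j0).
Qed.

Lemma condEx_le i u : size u = (i - L)%N -> (L <= i)%N ->
  condEx A i.+1 (pairvis m a i) u <= class_mean i + om.
Proof.
move=> su Li; rewrite (condEx_pairvis _ _ _ _ _ su Li) Ex_sum.
rewrite -[leRHS]mul1r -(A_sum1 i) mulr_suml; apply: ler_sum => j _.
rewrite ExZ ler_wpM2l //.
apply: (@le_trans _ _ (Tr A (i - L) L (trunc_edge m p0 a y j) (pos u))).
  by apply: le_Ex => // s _; apply: edge_le_trunc.
by have := Tr_trunc_near i j u su Li; rewrite ler_norml; lra.
Qed.

Lemma condEx_ge i u : size u = (i - L)%N -> (0 < L <= i)%N -> (i < L ^ 2)%N ->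
  class_mean i - om - small_mass y L i - small_mass y L i.+1 <=
  condEx A i.+1 (pairvis m a i) u.
Proof.
move=> su /andP[L0 Li] iL; have y2 : (2 <= y)%N by have := prime_gt1 p0_prime; lia.
rewrite (condEx_pairvis _ _ _ _ _ su Li).
have b1 : Ex A (i - L) L (fun s => (big_prime_dvd y (vadd (pos u) (pos s)))%:R) <= small_mass y L i.
  have := Ex_big_le y L (i - L) L (pos u); rewrite csum_pos su subnK // L0 leqnn.
  by apply => //; lia.
have b2 : Ex A (i - L) L (fun s => \sum_j A i j *
    (big_prime_dvd y (vadd (vadd (pos u) (pos s)) (step j)))%:R) <= small_mass y L i.+1.
  have := Ex_big_le y L (i - L) (L + 1) (pos u); rewrite csum_pos su addnA subnK // !addn1.
  have L1 : (0 < L <= L.+1)%N by rewrite L0 /=.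
  move=> /(_ erefl L1 y2 iL); apply: le_trans.
  rewrite -[L.+1]addn1 Ex_cat; apply: le_Ex => // s _ /=; rewrite subnK //.
  apply: ler_sum => j _; rewrite pos_cat vaddA.
  by have -> : pos [:: j] = step j by apply: funext => i'; rewrite /pos /step /= addn0.
apply: (@le_trans _ _ (Ex A (i - L) L (fun s =>
   \sum_j A i j * trunc_edge m p0 a y j (vadd (pos u) (pos s))
   - (big_prime_dvd y (vadd (pos u) (pos s)))%:R
   - \sum_j A i j * (big_prime_dvd y (vadd (vadd (pos u) (pos s)) (step j)))%:R))).
  rewrite !ExB.
  suff : class_mean i - om <=
    Ex A (i - L) L (fun s => \sum_j A i j * trunc_edge m p0 a y j (vadd (pos u) (pos s))) by lra.
  rewrite Ex_sum -[leLHS]mul1r -(A_sum1 i) mulr_suml; apply: ler_sum => j _.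
  rewrite ExZ ler_wpM2l //.
  by have := Tr_trunc_near i j u su Li; rewrite ler_norml /Tr; lra.
apply: le_Ex => // s ss.
have mean b : b = \sum_j A i j * b by rewrite -mulr_suml A_sum1 mul1r.
rewrite [X in _ - X - _]mean -!sumrB; apply: ler_sum => j _.
rewrite -!mulrBr ler_wpM2l //. apply: trunc_le_edge => //.
by rewrite csumD !csum_pos su ss; lia.
Qed.

Lemma class_mean_period i : class_mean (Q + i) = class_mean i.
Proof.
congr (_ * _); apply: eq_avg => v; congr (_ * _).
by rewrite /ind_sum modnDl.
Qed.

Lemma class_mean_ge0_le1 i : 0 <= class_mean i <= 1.
Proof.
have q0 : 0 < Q%:R :> R by rewrite ltr0n.
rewrite /class_mean mulr_ge0 //=; last first.
  rewrite -(avg_cst (k := k) Q 0 Q_gt0); apply: le_avg => v.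
  by rewrite mulr_ge0 // trunc_ge0.
rewrite mulrC -ler_pdivlMr // div1r -(avg_ind_sum Q i j0 Q_gt0); apply: le_avg => v.
by rewrite ler_piMl // trunc_le1.
Qed.

Lemma sum_class_mean : \sum_(i < Q) class_mean i = Q%:R * avg Q (trunc_edge m p0 a y j0).
Proof. by rewrite -mulr_sumr avg_sum_ind. Qed.

Lemma small_mass_ge0 I : 0 <= small_mass y L I.
Proof. by rewrite /small_mass addr_ge0 ?sumr_ge0 ?anti_bound_ge0 // => d _; apply: anti_bound_ge0. Qed.

Lemma condEx_ge0_le1 n f u : (forall s, 0 <= f s <= 1) -> 0 <= condEx A n f u <= 1.
Proof.
move=> f01; rewrite /condEx Ex_ge0 ?Ex_le1 //; first by move=> s _; have /andP[] := f01 (u ++ s).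
by move=> s _; have /andP[] := f01 (u ++ s).
Qed.

Lemma pairvis_ge0_le1 i s : 0 <= pairvis m a i s <= 1.
Proof. by rewrite /pairvis ler0n lern1 leq_b1. Qed.

(** For [i < L] there is no room for [L] mixing steps; both quantities lie in [0, 1], and
    [(i < L)%:R] records the trivial bound. *)
Lemma condEx_near i u : size u = (i - L)%N -> (0 < L)%N -> (i < L ^ 2)%N -> 0 <= om ->
  `|condEx A i.+1 (pairvis m a i) u - class_mean i| <=
  (i < L)%:R + om + (small_mass y L i + small_mass y L i.+1).
Proof.
move=> su L0 iL om0; have s0 := small_mass_ge0 i; have s1 := small_mass_ge0 i.+1.
have [ci|Li] := ltnP i L.
  have /andP[c1 c2] := condEx_ge0_le1 i.+1 _ u (pairvis_ge0_le1 i).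
  have /andP[c3 c4] := class_mean_ge0_le1 i.
  by rewrite ler_norml /=; apply/andP; split; lra.
have h1 := condEx_le i u su Li.
have := condEx_ge i u su _ iL; rewrite L0 Li => /(_ erefl) h2.
by rewrite add0r ler_norml; apply/andP; split; lra.
Qed.

Let tail : R := \sum_(d < L.+1 | (y <= d)%N) anti_bound dl d.-1 / d%:R.

Lemma sum_small_mass (h : nat -> nat) : (0 < L)%N ->
  (forall d, (0 < d)%N -> (\sum_(i < L ^ 2) (d %| h i) <= L ^ 2 %/ d + 1)%N) ->
  \sum_(i < L ^ 2) small_mass y L (h i) <= (2 * tail + anti_bound dl L) * (L ^ 2)%:R.
Proof.
move=> L0 hc; rewrite /small_mass big_split /= sumr_const card_ord mulrDl.
rewrite -(mulr_natr (anti_bound dl L)) lerD2r.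
under eq_bigr do rewrite big_mkcondr.
rewrite exchange_big /= /tail mulr_sumr mulr_suml; apply: ler_sum => d yd.
have d0 : (0 < d)%N by have := prime_gt1 p0_prime; lia.
have -> : \sum_(i < L ^ 2) (if (d %| h i)%N then anti_bound dl d.-1 else 0) =
    anti_bound dl d.-1 * (\sum_(i < L ^ 2) (d %| h i))%:R.
  rewrite natr_sum mulr_sumr; apply: eq_bigr => i _.
  by case: ifP => _; rewrite ?mulr1 ?mulr0.
rewrite [leRHS](_ : _ = anti_bound dl d.-1 * (2 * (L ^ 2)%:R / d%:R)); last by ring.
rewrite ler_wpM2l ?anti_bound_ge0 //.
(* The extra 1 is at most L^2/d because d <= L; hence the factor 2. *)
apply: (@le_trans _ _ ((L ^ 2 %/ d + 1)%:R)); first by rewrite ler_nat hc.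
rewrite ler_pdivlMr ?ltr0n // -!natrM ler_nat.
have dL := ltn_ord d; have := leq_trunc_div (L ^ 2) d; nia.
Qed.

Lemma sum_condEx_near (u : nat -> seq 'I_k) : (0 < L)%N -> 0 <= om ->
  (forall i, size (u i) = (i - L)%N) ->
  `|\sum_(i < L ^ 2) condEx A i.+1 (pairvis m a i) (u i)
    - (L ^ 2)%:R * avg Q (trunc_edge m p0 a y j0)| <=
  L%:R + Q%:R + (om + 4 * tail + 2 * anti_bound dl L) * (L ^ 2)%:R.
Proof.
move=> L0 om0 su.
have h1 := periodic_cesaro class_mean Q _ (L ^ 2) Q_gt0 class_mean_period
  class_mean_ge0_le1 sum_class_mean.
have h2 : `|\sum_(i < L ^ 2) condEx A i.+1 (pairvis m a i) (u i)
    - \sum_(i < L ^ 2) class_mean i| <=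
    L%:R + (om + 4 * tail + 2 * anti_bound dl L) * (L ^ 2)%:R.
  rewrite -sumrB; apply: le_trans (ler_norm_sum _ _ _) _.
  apply: (@le_trans _ _ (\sum_(i < L ^ 2) ((i < L)%:R + om +
      (small_mass y L i + small_mass y L i.+1)))).
    by apply: ler_sum => i _; apply: condEx_near.
  rewrite big_split big_split [X in _ + X <= _]big_split /=.
  have g1 := sum_small_mass id L0 (fun d => sum_dvdn d (L ^ 2)).
  have g2 : \sum_(i < L ^ 2) small_mass y L i.+1 <= (2 * tail + anti_bound dl L) * (L ^ 2)%:R.
    by apply: (sum_small_mass S) => // d d0; rewrite sum_dvdn_succ // leq_addr.
  have g3 : \sum_(i < L ^ 2) (i < L)%:R <= L%:R :> R.
    rewrite -natr_sum ler_nat; apply: (@leq_trans (minn (L ^ 2) L)); last exact: geq_minr.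
    elim: (L ^ 2)%N => [|n IH]; first by rewrite big_ord0.
    by rewrite big_ord_recr /=; apply: leq_trans (leq_add IH (leqnn _)) _; case: (ltnP n L); lia.
  rewrite sumr_const card_ord -(mulr_natr om); lra.
rewrite (_ : _ - _ = (\sum_(i < L ^ 2) condEx A i.+1 (pairvis m a i) (u i)
    - \sum_(i < L ^ 2) class_mean i) + (\sum_(i < L ^ 2) class_mean i
     - (L ^ 2)%:R * avg Q (trunc_edge m p0 a y j0))); last by ring.
by apply: le_trans (ler_normD _ _) _; lra.
Qed.

End Truncation.

(** As d - 1 >= 64^b, [dyadic_tail] applies from block [b] on; 252 is 126 times the numerator 2 of
    [anti_bound]. *)
Lemma tail_le b L : \sum_(d < L.+1 | ((64 ^ b).+1 <= d)%N) anti_bound dl d.-1 / d%:R <=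
  252 / dl / 2 ^+ b.
Proof.
have p2 n : 0 < 2 ^+ n :> R by rewrite exprn_gt0.
pose F (e : nat) : R := if (64 ^ b <= e)%N then (2 ^+ trunc_log 64 e * e%:R)^-1 else 0.
have F0 e : 0 <= F e by rewrite /F; case: ifP => // _; rewrite invr_ge0 mulr_ge0 // ltW.
apply: (@le_trans _ _ (2 / dl * \sum_(e < L) F e)).
  rewrite big_mkcond big_ord_recl /= add0r mulr_sumr; apply: ler_sum => e _.
  rewrite /F /bump /= add1n ltnS; case: ifP => // be; last by rewrite mulr0.
  have e0 : (0 < e)%N by apply: leq_trans be; rewrite expn_gt0.
  rewrite /anti_bound add0n -[leLHS]mulrA ler_wpM2l ?divr_ge0 ?(ltW dl_gt0) //.
  rewrite invfM ler_wpM2l ?invr_ge0 ?(ltW (p2 _)) //.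
  by rewrite lef_pV2 ?posrE ?ltr0n // ler_nat.
have -> : 252 / dl / 2 ^+ b = 2 / dl * (126 * (2 ^+ b)^-1) :> R by field; rewrite !gt_eqF.
rewrite ler_wpM2l ?divr_ge0 ?(ltW dl_gt0) //.
apply: (@le_trans _ _ (\sum_(e < 64 ^ (b + L)) F e)).
  apply: le_sum_widen => //; apply: leq_trans (ltnW (ltn_expl L (isT : (1 < 64)%N))) _.
  by rewrite leq_exp2l // leq_addl.
rewrite /F -big_mkcond -(big_geq_mkord _ _ xpredT (fun e => (2 ^+ trunc_log 64 e * e%:R)^-1)) /=.
apply: le_trans (dyadic_tail b L) _.
by rewrite ler_wpM2l // lerBlDr lerDl invr_ge0 ltW.
Qed.

Lemma inv_pow2_small (C e : R) : 0 < e -> exists b0, forall b, (b0 <= b)%N -> C / 2 ^+ b <= e.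
Proof.
move=> e0; exists (Num.bound (`|C| / e)) => b bb.
rewrite ler_pdivrMr ?exprn_gt0 // mulrC -ler_pdivrMr //.
apply: (@le_trans _ _ (`|C| / e)); first by rewrite ler_wpM2r ?invr_ge0 ?(ltW e0) ?ler_norm.
apply: le_trans (ltW (archi_boundP _)) _; first by rewrite divr_ge0 // ltW.
by rewrite -natrX ler_nat; apply: leq_trans bb _; rewrite ltnW // ltn_expl.
Qed.

Lemma pow_small (r e : R) : 0 <= r < 1 -> 0 < e -> exists l, r ^+ l <= e.
Proof.
move=> /andP[r0 r1] e0.
have [->|rn0] := eqVneq r 0; first by exists 1%N; rewrite expr1 ltW.
have rp : 0 < r by rewrite lt_def rn0.
have h l : r ^+ l * (1 + l%:R * (1 - r)) <= 1.
  elim: l => [|l IH]; first by rewrite expr0 mul0r addr0 mulr1.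
  apply: le_trans IH; rewrite exprSr -mulrA ler_wpM2l ?exprn_ge0 // -natr1.
  have := mulr_ge0 (ler0n R l) (sqr_ge0 (1 - r)); have := sqr_ge0 (1 - r).
  rewrite expr2; nra.
pose l := Num.bound ((e * (1 - r))^-1); exists l.
have q0 : 0 < e * (1 - r) by rewrite mulr_gt0 // subr_gt0.
have hl : 1 <= l%:R * (e * (1 - r)).
  by rewrite -ler_pdivrMr // div1r ltW // archi_boundP // invr_ge0 ltW.
have := h l; set x := r ^+ l => hx.
have x0 : 0 <= x by rewrite exprn_ge0.
rewrite leNgt; apply/negP => xe.
have : e * (l%:R * (1 - r)) <= x * (l%:R * (1 - r)).
  by rewrite ler_wpM2r ?(ltW xe) // mulr_ge0 // subr_ge0 ltW.
lra.
Qed.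

Lemma cond_mean m p0 a e0 c : prime p0 -> m = (p0 ^ e0.+1)%N ->
  (forall e : R, 0 < e -> exists Y, forall y, (Y <= y)%N ->
     `|avg (modulus m p0 y) (trunc_edge m p0 a y j0) - c| <= e) ->
  forall e : R, 0 < e -> exists L0, forall L, (L0 <= L)%N ->
  forall u : nat -> seq 'I_k, (forall i, size (u i) = (i - L)%N) ->
  `|\sum_(i < L ^ 2) condEx A i.+1 (pairvis m a i) (u i) - (L ^ 2)%:R * c| <= e * (L ^ 2)%:R.
Proof.
(* Ten shares of error: two for L + Q, then 1 + 4 + 2 for mixing, tail and [anti_bound], and one for
   the distance of the truncated density from [c]. *)
move=> pp0 mE hc e e_gt0; pose e' := e / 10.
have e'_gt0 : 0 < e' by rewrite divr_gt0.
have m0 : (0 < m)%N by rewrite mE expn_gt0 prime_gt0.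
have pm : (p0 %| m)%N by rewrite mE dvdn_exp.
have [Y hY] := hc e' e'_gt0.
have [b0 hb0] := inv_pow2_small (252 / dl) e' e'_gt0.
have [b1 hb1] := inv_pow2_small (2 / dl) e' e'_gt0.
pose b := maxn b0 (maxn Y p0).
pose y := (64 ^ b).+1.
have by_ : (b < y)%N by rewrite ltnS ltnW // ltn_expl.
have yY : (Y <= y)%N by lia.
have yp : (p0 < y)%N by lia.
pose Q := modulus m p0 y.
have Q0 : (0 < Q)%N by apply: modulus_gt0.
have per j : periodic Q (trunc_edge m p0 a y j : ('I_k -> nat) -> R) by apply: periodic_trunc.
have dl1 := dl_le1 A dl j0 A_ge0 A_sum1 A_ge.
pose eta := dl ^+ (k * Q) * dl ^+ (k * Q).
have eta0 : 0 < eta by rewrite mulr_gt0 ?exprn_gt0.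
have eta1 : eta <= 1 by rewrite mulr_ile1 ?exprn_ge0 ?exprn_ile1 ?(ltW dl_gt0).
have [|l hl] := pow_small (1 - eta) e' _ e'_gt0; first by apply/andP; split; lra.
pose x := Num.bound ((1 + Q%:R) / e').
exists (maxn (k * Q * l) (maxn (64 ^ b1) x.+1)) => L.
rewrite !geq_max => /and3P[hL1 hL2 hL3] u su.
have L0 : (0 < L)%N := leq_ltn_trans (leq0n x) hL3.
have mix t j : osc_le Q (Tr A t L (trunc_edge m p0 a y j)) e'.
  move=> v w vw; apply: le_trans hl.
  apply: (mixing A dl j0) vw => //.
  move=> v' w' _; have := trunc_le1 m p0 a y j v' (R := R); have := trunc_ge0 m p0 a y j w' (R := R).
  lra.
have := sum_condEx_near m p0 a y Q e' L pp0 yp Q0 per mix u L0 (ltW e'_gt0) su.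
have t1 : \sum_(d < L.+1 | (y <= d)%N) anti_bound dl d.-1 / d%:R <= e'.
  by apply: le_trans (tail_le b L) (hb0 _ _); rewrite leq_maxl.
have t2 : anti_bound dl L <= e'.
  by apply: hb1; rewrite trunc_log_max.
have t3 : L%:R + Q%:R <= 2 * e' * (L ^ 2)%:R.
  have xL : (1 + Q%:R) / e' <= L%:R.
    apply: le_trans (ltW (archi_boundP _)) _; first by rewrite divr_ge0 ?addr_ge0 // ltW.
    by rewrite ler_nat ltnW.
  rewrite ler_pdivrMr // in xL.
  have L1 : 1 <= L%:R :> R by rewrite ler1n.
  have Q00 : 0 <= Q%:R :> R by [].
  rewrite natrX.
  apply: (@le_trans _ _ (L%:R * (1 + Q%:R))); first by nra.
  apply: (@le_trans _ _ (L%:R * (L%:R * e'))); first by rewrite ler_wpM2l.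
  have : 0 <= L%:R ^+ 2 * e' by rewrite mulr_ge0 // ltW.
  rewrite expr2; lra.
have t4 := hY y yY; rewrite -/Q in t4.
set S := \sum_(i < L ^ 2) condEx _ _ _ _; set V := avg Q _ in t4 *.
have t5 : `|(L ^ 2)%:R * V - (L ^ 2)%:R * c| <= e' * (L ^ 2)%:R.
  by rewrite -mulrBr normrM normr_nat mulrC ler_wpM2r.
move=> t6; rewrite (_ : S - _ = (S - (L ^ 2)%:R * V) + ((L ^ 2)%:R * V - (L ^ 2)%:R * c)); last by ring.
apply: le_trans (ler_normD _ _) _; apply: le_trans (lerD t6 t5) _.
set T := \sum_(_ < _ | _) _ in t1 *.
have n0 : 0 <= (L ^ 2)%:R :> R by [].
have : (e' + 4 * T + 2 * anti_bound dl L) * (L ^ 2)%:R <= (7 * e') * (L ^ 2)%:R.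
  by rewrite ler_wpM2r //; lra.
have -> : e = 10 * e' by rewrite /e'; field.
lra.
Qed.

End ConditionalMean.

(** * From the measure to finite expectations *)

Local Open Scope classical_set_scope.

Section WalkPrefix.
Context {k : nat}.

Definition walk_prefix (w : nat -> 'I_k) (n : nat) : seq 'I_k := [seq w t | t <- iota 0 n].

Lemma size_walk_prefix w n : size (walk_prefix w n) = n.
Proof. by rewrite size_map size_iota. Qed.

Lemma walk_prefixS w n : walk_prefix w n.+1 = rcons (walk_prefix w n) (w n).
Proof. by rewrite /walk_prefix -addn1 iotaD map_cat cats1. Qed.

Lemma take_walk_prefix w m n : (m <= n)%N -> take m (walk_prefix w n) = walk_prefix w m.
Proof. by move=> mn; rewrite /walk_prefix -map_take take_iota (minn_idPl mn). Qed.

Lemma pos_walk_prefix w n : pos (walk_prefix w n) = walk_pos w n.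
Proof. by apply: funext => i; rewrite /pos /walk_prefix /walk_pos count_map. Qed.

End WalkPrefix.

Section WalkLaw.
Context {R : realType} {d : measure_display} {T : measurableType d}
  (P : probability T R) {k : nat} (A : nat -> 'I_k -> R) (W : nat -> T -> 'I_k).
Hypothesis mW : forall t j, measurable [set x | W t x = j].
Hypothesis PW : forall t j, P [set x | W t x = j] = (A t j)%:E.
Hypothesis iW : indep_steps P W.

Let pre n x := walk_prefix (W^~ x) n.

Lemma step_prob_ge0 t j : 0 <= A t j.
Proof. by rewrite -lee_fin -PW. Qed.

Lemma measurable_pre n (B : seq 'I_k -> Prop) : measurable [set x | B (pre n x)].
Proof.
elim: n B => [|n IH] B.
  case: (pselect (B [::])) => b.
    by rewrite (_ : [set x | _] = setT) //; apply/seteqP; split.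
  by rewrite (_ : [set x | _] = set0) //; apply/seteqP; split.
rewrite (_ : [set x | _] = \big[setU/set0]_(j < k)
    ([set x | W n x = j] `&` [set x | B (rcons (pre n x) j)])).
  by apply: bigsetU_measurable => j _; apply: measurableI => //; apply: (IH (fun s => B (rcons s j))).
apply/seteqP; split => x; rewrite -bigcup_seq /= /pre walk_prefixS.
  by move=> Bx; exists (W n x); rewrite //= mem_index_enum.
by move=> [j _ [<-]].
Qed.

Definition path_weight (s : seq 'I_k) (j0 : 'I_k) : R :=
  \prod_(t <- iota 0 (size s)) A t (nth j0 s t).

Lemma path_weight_rcons s j j0 : path_weight (rcons s j) j0 = path_weight s j0 * A (size s) j.
Proof.
rewrite /path_weight size_rcons -addn1 iotaD big_cat /= big_seq1 add0n.
rewrite nth_rcons ltnn eqxx; congr (_ * _).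
rewrite !big_seq; apply: eq_bigr => t; rewrite mem_iota add0n => /andP[_ ts].
by rewrite nth_rcons ts.
Qed.

Lemma cylinder_prob s j0 : P [set x | pre (size s) x = s] = (path_weight s j0)%:E.
Proof.
rewrite (_ : [set x | _] = \big[setI/setT]_(t <- iota 0 (size s)) [set x | W t x = nth j0 s t]).
  rewrite (iW _ (nth j0 s)) ?iota_uniq // /path_weight.
  elim: (iota 0 (size s)) => [|t r IH]; first by rewrite !big_nil.
  by rewrite !big_cons PW EFinM IH.
rewrite -bigcap_seq; apply/seteqP; split => x /=.
  move=> e t /=; rewrite mem_iota add0n => /andP[_ ts].
  by rewrite -{1}e (nth_map 0%N) ?size_iota // nth_iota.
move=> h; apply: (@eq_from_nth _ j0); rewrite size_walk_prefix // => t ts.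
rewrite (nth_map 0%N) ?size_iota // nth_iota // add0n; apply: h.
by rewrite /= mem_iota.
Qed.

(** Only upper bounds on bad events are used, so Boole's inequality over the next direction suffices
    and the exact law of the prefix is not computed. *)
Lemma pre_prob_le_cond n s (B : pred (seq 'I_k)) j0 :
  (P [set x | pre (size s) x = s /\ B (pre (size s + n) x)] <=
   (path_weight s j0 * Ex A (size s) n (fun u => (B (s ++ u))%:R))%:E)%E.
Proof.
elim: n s => [|n IH] s /=.
  rewrite cats0 addn0; case: (boolP (B s)) => Bs; last first.
    rewrite mulr0 (_ : [set x | _] = set0) ?measure0 //.
    by apply/seteqP; split => // x [/= ->]; rewrite (negPf Bs).
  rewrite mulr1 -cylinder_prob le_measure ?inE //; last by move=> x [].
    by apply: (measurable_pre (size s) (fun u => u = s /\ B u)).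
  exact: (measurable_pre (size s) (fun u => u = s)).
pose F (i : nat) := [set x | nat_of_ord (W (size s) x) = i /\
   (pre (size s) x = s /\ B (pre (size s + n.+1) x))].
have mF i : measurable (F i).
  rewrite (_ : F i = [set x | (fun u => nat_of_ord (nth j0 u (size s)) = i /\
     (take (size s) u = s /\ B u)) (pre (size s + n.+1) x)]).
    exact: (measurable_pre _ (fun u => nat_of_ord (nth j0 u (size s)) = i /\
     (take (size s) u = s /\ B u))).
  apply: funext => x; rewrite /F /= take_walk_prefix ?leq_addr // (nth_map 0%N); last first.
    by rewrite size_iota; lia.
  by rewrite nth_iota ?add0n //; lia.
apply: (@le_trans _ _ (P (\big[setU/set0]_(i < k) F i))).
  rewrite le_measure ?inE //.
  - rewrite (_ : [set x | _] = [set x | (fun u =>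
     (take (size s) u = s /\ B u)) (pre (size s + n.+1) x)]).
      exact: (measurable_pre _ (fun u => take (size s) u = s /\ B u)).
    by apply: funext => x /=; rewrite take_walk_prefix ?leq_addr.
  - by apply: bigsetU_measurable.
  - move=> x [xs xB]; rewrite -bigcup_mkord; exists (nat_of_ord (W (size s) x)) => //=.
apply: le_trans (Boole_inequality P (fun i _ => mF i)) _.
rewrite mulr_sumr -sumEFin; apply: lee_sum => j _.
have := IH (rcons s j); rewrite path_weight_rcons size_rcons mulrA.
rewrite (_ : (fun u => _) = (fun u => (B (s ++ j :: u))%:R)); last first.
  by apply: funext => u; rewrite cat_rcons.
apply: le_trans; rewrite addSnnS le_measure ?inE //.
  rewrite (_ : [set x | _] = [set x | (fun u =>
     (take (size s).+1 u = rcons s j /\ B u)) (pre (size s + n.+1) x)]).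
    exact: (measurable_pre _ (fun u => take (size s).+1 u = rcons s j /\ B u)).
  by apply: funext => x /=; rewrite take_walk_prefix //; lia.
move=> x [/= /ord_inj Wj [xs xB]]; split => //.
by rewrite /pre walk_prefixS -/(pre _ x) xs Wj.
Qed.

Lemma pre_prob_le n (B : pred (seq 'I_k)) (j0 : 'I_k) :
  (P [set x | B (pre n x)] <= (Ex A 0 n (fun u => (B u)%:R))%:E)%E.
Proof.
have := pre_prob_le_cond n [::] B j0.
rewrite /path_weight big_nil mul1r add0n /=; apply: le_trans.
rewrite le_measure ?inE //; first exact: (measurable_pre n B).
  rewrite (_ : [set x | _] = [set x | B (pre n x)]); first exact: (measurable_pre n B).
  by apply/seteqP; split => x //= [].
Qed.

End WalkLaw.

(** * Almost sure convergence *)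

Lemma ae_eventually_notin {d} {T : measurableType d} {R : realType} (P : probability T R)
    (B : nat -> set T) (C : R) :
  (forall N, measurable (B N)) ->
  (forall N, (P (B N) <= (C / (N.+1 ^ 2)%:R)%:E)%E) -> 0 <= C ->
  {ae P, forall x, exists N0, forall N, (N0 <= N)%N -> ~ B N x}.
Proof.
move=> mB PB C0.
have sumP n : (\sum_(0 <= i < n) P (B i) <= (2 * C)%:E)%E.
  apply: (@le_trans _ _ (\sum_(0 <= i < n) (C / (i.+1 ^ 2)%:R)%:E)%E).
    by apply: lee_sum.
  rewrite sumEFin lee_fin; apply: (@le_trans _ _ (2 * C * (1 - n.+1%:R^-1))); last first.
    by rewrite ler_piMr ?mulr_ge0 // gerBl invr_ge0.
  elim: n => [|n IH]; first by rewrite big_geq // invr1 subrr mulr0.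
  rewrite big_nat_recr //=.
  have a1 : 0 < n.+1%:R :> R by rewrite ltr0n.
  have a2 : n.+2%:R = n.+1%:R + 1 :> R by rewrite -natr1.
  rewrite natrX a2; set a := n.+1%:R in a1 IH *.
  (* For a >= 1, 1/a^2 <= 2/(a(a + 1)), which telescopes to the total 2C. *)
  have : C / a ^+ 2 <= 2 * C * (a^-1 - (a + 1)^-1).
    rewrite (_ : 2 * C * (a^-1 - (a + 1)^-1) = C * (2 / (a * (a + 1)))); last first.
      by field; rewrite !gt_eqF //; lra.
    rewrite ler_wpM2l // ler_pdivlMr ?mulr_gt0 //; last lra.
    rewrite ler_pdivrMl ?exprn_gt0 //.
    have : 1 <= a by rewrite /a ler1n.
    rewrite expr2; nra.
  move: IH; set x := a^-1; set z := (a + 1)^-1; set S := \sum_(0 <= i < n) _.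
  by set X := C / a ^+ 2; lra.
have L0 : P (lim_sup_set B) = 0%E.
  apply: lim_sup_set_cvg0 => //.
  apply: (@le_lt_trans _ _ (2 * C)%:E); last exact: ltry.
  apply: lime_le; first by apply: is_cvg_nneseries.
  by apply: nearW => n; apply: sumP.
exists (lim_sup_set B); split => //.
  apply: bigcapT_measurable => n; apply: bigcup_measurable => i _; exact: mB.
move=> x /= nx n _ /=; apply: contrapT => h; apply: nx; exists n => N nN BN.
by apply: h; exists N.
Qed.

Section LawOfLargeNumbers.
Context {R : realType} {d : measure_display} {T : measurableType d}
  (P : probability T R) {k : nat} (A : nat -> 'I_k -> R) (W : nat -> T -> 'I_k) (j0 : 'I_k).
Hypothesis mW : forall t j, measurable [set x | W t x = j].
Hypothesis PW : forall t j, P [set x | W t x = j] = (A t j)%:E.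
Hypothesis iW : indep_steps P W.
Hypothesis A_sum1 : forall t, \sum_j A t j = 1.
Variable y : nat -> seq 'I_k -> R.
Hypothesis y01 : forall i s, 0 <= y i s <= 1.

Let A_ge0 := step_prob_ge0 P A W PW.

Lemma ae_sum_innov_small (e : R) : 0 < e ->
  {ae P, forall x, exists N0, forall N, (N0 <= N)%N ->
    `|\sum_(i < (N.+1 ^ 2) ^ 2) innov A (N.+1 ^ 2) y i (walk_prefix (W^~ x) ((N.+1 ^ 2) ^ 2))|
      <= e * ((N.+1 ^ 2) ^ 2)%:R}.
Proof.
move=> e0.
pose n N := ((N.+1 ^ 2) ^ 2)%N.
pose S N s := \sum_(i < n N) innov A (N.+1 ^ 2) y i s.
pose bad N : pred (seq 'I_k) := fun s => e * (n N)%:R < `|S N s|.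
(* The 3 comes from 2L + 1 <= 3L: with n = L^2, the variance n(2L + 1) over (e n)^2 is at most
   3/(e^2 L), and L = (N + 1)^2. *)
have := ae_eventually_notin P (fun N => [set x | bad N (walk_prefix (W^~ x) (n N))]) (3 / e ^+ 2).
have h0 : 0 <= 3 / e ^+ 2 by rewrite divr_ge0 ?sqr_ge0.
move=> /(_ (fun N => measurable_pre W mW (n N) (fun s => bad N s)) _ h0) h.
apply: filterS (h _) => [x [N0 hN]|N].
  by exists N0 => N /hN /negP; rewrite /bad -leNgt.
apply: le_trans (pre_prob_le P A W mW PW iW (n N) (bad N) j0) _.
set L := (N.+1 ^ 2)%N; rewrite lee_fin.
have n0 : 0 < (n N)%:R :> R by rewrite ltr0n !expn_gt0.
have en0 : 0 < e * (n N)%:R by rewrite mulr_gt0.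
apply: (@le_trans _ _ (Ex A 0 (n N) (fun s => S N s ^+ 2 / (e * (n N)%:R) ^+ 2))).
  apply: le_Ex => // s _; case: (boolP (bad N s)) => b; last by rewrite divr_ge0 ?sqr_ge0.
  rewrite ler_pdivlMr ?exprn_gt0 // mul1r -[leRHS]real_normK ?num_real //.
  by rewrite lerXn2r ?nnegrE ?(ltW en0) // ltW.
rewrite ExZr ler_pdivrMr ?exprn_gt0 //.
apply: le_trans (innov_variance A A_ge0 A_sum1 L y y01 (n N)) _.
have Lp : 0 < L%:R :> R by rewrite ltr0n expn_gt0.
rewrite [leRHS](_ : _ = 3 * (n N)%:R ^+ 2 / L%:R); last by field; rewrite !gt_eqF.
rewrite ler_pdivlMr // -natrX -!natrM ler_nat.
rewrite /n -/L.
have : (0 < L)%N by rewrite expn_gt0.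
nia.
Qed.

Lemma ae_sum_condEx (e : R) : 0 < e ->
  {ae P, forall x, exists N0, forall N, (N0 <= N)%N ->
    `|\sum_(i < (N.+1 ^ 2) ^ 2) y i (walk_prefix (W^~ x) i.+1)
      - \sum_(i < (N.+1 ^ 2) ^ 2) condEx A i.+1 (y i) (walk_prefix (W^~ x) (i - N.+1 ^ 2))|
      <= e * ((N.+1 ^ 2) ^ 2)%:R}.
Proof.
move=> e0; apply: filterS (ae_sum_innov_small e e0) => x [N0 hN]; exists N0 => N /hN.
apply: le_trans; rewrite -sumrB le_eqVlt; apply/orP; left; apply/eqP; congr `|_|.
apply: eq_bigr => i _; rewrite /innov !take_walk_prefix //.
by have := ltn_ord i; lia.
Qed.

End LawOfLargeNumbers.

(* A nonnegative sum is monotone in its length, so the limit along fourth powers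
   determines the limit. *)
Lemma average_interpolation {R : realType} (f : nat -> R) (c : R) :
  (forall i, 0 <= f i) ->
  (forall e : R, 0 < e -> exists N0, forall N, (N0 <= N)%N ->
     `|\sum_(i < (N.+1 ^ 2) ^ 2) f i - ((N.+1 ^ 2) ^ 2)%:R * c| <= e * ((N.+1 ^ 2) ^ 2)%:R) ->
  forall e : R, 0 < e -> exists n0, forall n, (n0 <= n)%N ->
     `|\sum_(i < n) f i - n%:R * c| <= e * n%:R.
Proof.
move=> f0 hf e e0.
(* Consecutive fourth powers have ratio at most 16, so e/32 costs e/2. Their gap is at most 15/(N +
   1) times the smaller one, so N >= 30|c|/e makes |c| times the gap at most e n/2. *)
pose e1 := e / 32; have e10 : 0 < e1 by rewrite divr_gt0.
have [N0 hN] := hf e1 e10.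
pose N1 := maxn N0 (Num.bound (30 * `|c| / e)).
pose q N := ((N.+1 ^ 2) ^ 2)%N.
exists (q N1) => n nq.
have [N [NN1 qn nqS]] : exists N, [/\ (N1 <= N)%N, (q N <= n)%N & (n <= q N.+1)%N].
  have qge N : (N <= q N)%N by rewrite /q; nia.
  have ex : exists N, (n <= q N.+1)%N && (N1 <= N)%N.
    exists (maxn N1 n); rewrite leq_maxl andbT; apply: leq_trans (qge _).
    by rewrite ltnW // ltnS leq_maxr.
  case: (ex_minnP ex) => N /andP[a1 a2] Nmin; exists N; split => //.
  have [->//|ne] := eqVneq N N1; rewrite leqNgt; apply/negP => nN.
  have N1N : (N1 < N)%N by rewrite ltn_neqAle eq_sym ne.
  have := Nmin N.-1; rewrite prednK; last by lia.
  by rewrite (ltnW nN) /=; lia.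
have mono a b : (a <= b)%N -> \sum_(i < a) f i <= \sum_(i < b) f i by move=> ab; apply: le_sum_widen.
have h1 := hN N (leq_trans (leq_maxl _ _) NN1).
have h2 := hN N.+1 (leq_trans (leq_trans (leq_maxl _ _) NN1) (leqnSn N)).
rewrite -!/(q _) in h1 h2.
have m1 := mono _ _ qn; have m2 := mono _ _ nqS.
have q1 : (q N.+1 <= 16 * q N)%N by rewrite /q; nia.
have q2 : ((q N.+1 - q N) * N.+1 <= 15 * q N)%N by rewrite /q; nia.
set sn := \sum_(i < n) f i in m1 m2 *.
have r1 : (q N.+1)%:R <= 16 * (q N)%:R :> R by rewrite -natrM ler_nat.
have rqn : (q N)%:R <= n%:R :> R by rewrite ler_nat.
have rnq : n%:R <= (q N.+1)%:R :> R by rewrite ler_nat.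
have qq : (q N <= q N.+1)%N by exact: leq_trans qn nqS.
have cgap : `|c| * ((q N.+1)%:R - (q N)%:R) <= e / 2 * n%:R.
  have hb : 30 * `|c| <= e * N.+1%:R.
    rewrite [leRHS]mulrC -ler_pdivrMr //.
    apply: le_trans (ltW (archi_boundP _)) _; first by rewrite divr_ge0 ?mulr_ge0 // ltW.
    rewrite ler_nat; apply: leq_trans (leq_maxr N0 _) _; exact: leq_trans NN1 (leqnSn N).
  rewrite -natrB //; set D := (_ - _)%N in q2 *.
  have rq2 : D%:R * N.+1%:R <= 15 * (q N)%:R :> R by rewrite -!natrM ler_nat.
  have D0 : 0 <= D%:R :> R by [].
  have s1 : 30 * `|c| * D%:R <= e * N.+1%:R * D%:R by rewrite ler_wpM2r.
  have s2 : e * (D%:R * N.+1%:R) <= e * (15 * (q N)%:R) by rewrite ler_wpM2l // ltW.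
  have s3 : e * (q N)%:R <= e * n%:R by rewrite ler_wpM2l // ltW.
  lra.
have cn : `|n%:R * c - (q N)%:R * c| <= `|c| * ((q N.+1)%:R - (q N)%:R).
  rewrite -mulrBl normrM mulrC ler_wpM2l // ger0_norm ?subr_ge0 //; lra.
have cn' : `|(q N.+1)%:R * c - n%:R * c| <= `|c| * ((q N.+1)%:R - (q N)%:R).
  rewrite -mulrBl normrM mulrC ler_wpM2l // ger0_norm ?subr_ge0 //; lra.
have g1 : e1 * (q N.+1)%:R <= e / 2 * n%:R.
  have : e1 * (q N.+1)%:R <= e1 * (16 * n%:R) by rewrite ler_wpM2l ?(ltW e10) //; lra.
  rewrite /e1; lra.
have g2 : e1 * (q N)%:R <= e / 2 * n%:R.
  by apply: le_trans g1; rewrite ler_wpM2l ?(ltW e10) // ler_nat.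
move: h1 h2 cn cn'; rewrite !ler_norml => /andP[a1 a2] /andP[b1 b2] /andP[c1 c2] /andP[d1 d2].
apply/andP; split; lra.
Qed.

(** * Passage to the almost sure limit *)

Section Limit.
Context {R : realType} {d : measure_display} {T : measurableType d}
  (P : probability T R) {k : nat} (A : nat -> 'I_k -> R) (W : nat -> T -> 'I_k)
  (dl : R) (j0 j1 : 'I_k).
Hypothesis mW : forall t j, measurable [set x | W t x = j].
Hypothesis PW : forall t j, P [set x | W t x = j] = (A t j)%:E.
Hypothesis iW : indep_steps P W.
Hypothesis A_sum1 : forall t, \sum_j A t j = 1.
Hypothesis dl_gt0 : 0 < dl.
Hypothesis A_ge : forall t j, dl <= A t j.
Hypothesis j01 : j0 != j1.

Lemma Rbar_pairvis m a n (w : nat -> 'I_k) :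
  Rbar R w m a n = n%:R^-1 * \sum_(i < n.+1) pairvis m a i (walk_prefix w i.+1).
Proof.
rewrite /Rbar; congr (_ * _); rewrite big_ord_recl.
(* The index 0 may be added because the origin is not visible: the gcd of its coordinates is 0. *)
have -> : pairvis m a (ord0 : 'I_n.+1) (walk_prefix w (ord0 : 'I_n.+1).+1) = 0 :> R.
  by rewrite /pairvis take_walk_prefix // pos_walk_prefix /visible big1 // andbF.
rewrite add0r big_add1 big_mkord big_mkcond; apply: eq_bigr => i _.
rewrite lift0 /pairvis take_walk_prefix // !pos_walk_prefix /Xvis -natrM mulnb.
by case: ifP.
Qed.

Lemma ae_Rbar_cvg m p0 a e0 c : prime p0 -> m = (p0 ^ e0.+1)%N ->
  (forall e : R, 0 < e -> exists Y, forall y, (Y <= y)%N ->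
     `|avg (modulus m p0 y) (trunc_edge m p0 a y j0) - c| <= e) ->
  {ae P, forall x, Rbar R (fun t => W t x) m a n @[n --> \oo] --> c}.
Proof.
move=> pp0 mE hc.
have pv01 i (s : seq 'I_k) : 0 <= (pairvis m a i s : R) <= 1 by rewrite /pairvis ler0n lern1 leq_b1.
have mean := cond_mean A dl j0 j1 A_sum1 dl_gt0 A_ge j01 m p0 a e0 c pp0 mE hc.
(* The null set depends on the tolerance, so the tolerances 1/(j + 1) are used and countably many
   null sets are merged. *)
have ae1 : {ae P, forall x, forall j : nat, exists N0, forall N, (N0 <= N)%N ->
    `|\sum_(i < (N.+1 ^ 2) ^ 2) pairvis m a i (walk_prefix (W^~ x) i.+1)
      - \sum_(i < (N.+1 ^ 2) ^ 2) condEx A i.+1 (pairvis m a i) (walk_prefix (W^~ x) (i - N.+1 ^ 2))|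
      <= j.+1%:R^-1 * ((N.+1 ^ 2) ^ 2)%:R}.
  apply: ae_foralln => j.
  apply: (ae_sum_condEx P A W j0 mW PW iW A_sum1 _ pv01).
  by rewrite invr_gt0.
apply: filterS ae1 => x hx.
have key : forall e : R, 0 < e -> exists n0, forall n, (n0 <= n)%N ->
    `|\sum_(i < n) pairvis m a i (walk_prefix (W^~ x) i.+1) - n%:R * c| <= e * n%:R.
  apply: (average_interpolation (fun i => pairvis m a i (walk_prefix (W^~ x) i.+1)) c) =>
      [i|e e_gt0]; first by have /andP[] := pv01 i (walk_prefix (W^~ x) i.+1).
  have e2 : 0 < e / 2 by rewrite divr_gt0.
  have [N1 h1] := hx (Num.bound (e / 2)^-1).
  have [L0 h2] := mean (e / 2) e2.
  exists (maxn N1 L0) => N NN.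
  have LN : (L0 <= N.+1 ^ 2)%N.
    by apply: leq_trans (leq_trans (leq_maxr N1 L0) NN) _; nia.
  have /= := h2 _ LN (fun i => walk_prefix (W^~ x) (i - N.+1 ^ 2)) (fun i => size_walk_prefix _ _).
  have /= := h1 N (leq_trans (leq_maxl _ _) NN).
  set s1 := \sum_(_ < _) _; set s2 := \sum_(_ < _) _; set n := ((N.+1 ^ 2) ^ 2)%N.
  have be : (Num.bound (e / 2)^-1).+1%:R^-1 * n%:R <= e / 2 * n%:R.
    rewrite ler_wpM2r // -[leRHS]invrK lef_pV2 ?posrE ?invr_gt0 //.
    apply: le_trans (ltW (archi_boundP _)) _; first by rewrite invr_ge0 ltW.
    by rewrite ler_nat.
  rewrite !ler_norml => /andP[a1 a2] /andP[b1 b2]; apply/andP.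
  move: be a1 a2 b1 b2; move: (n%:R : R) ((Num.bound (e / 2)^-1).+1%:R^-1 : R) s1 s2 => nr r s1 s2 *.
  by split; lra.
apply/cvgrPdist_le => e_ e_gt0; pose e : R := e_; rewrite -/e in e_gt0 *.
have e4 : 0 < e / 4 by rewrite divr_gt0.
have [n0 hn] := key _ e4.
(* [Rbar] is [n.+1] terms divided by [n]: the surplus |c| and the error (e/4)(n + 1) are each at
   most e n/2. *)
exists (maxn n0 (Num.bound (2 * `|c| / e)).+1) => // n /= nn.
have n1 : 1 <= n%:R :> R by rewrite ler1n; lia.
have n0' : 0 < n%:R :> R by lra.
have cb : 2 * `|c| <= e * n%:R.
  rewrite [leRHS]mulrC -ler_pdivrMr //.
  apply: le_trans (ltW (archi_boundP _)) _; first by rewrite divr_ge0 ?mulr_ge0 // ltW.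
  by rewrite ler_nat (ltnW (leq_trans (leq_maxr n0 _) nn)).
rewrite Rbar_pairvis; have := hn n.+1 (leqW (leq_trans (leq_maxl _ _) nn)).
set s := \sum_(_ < _) _.
have -> : c - n%:R^-1 * s = n%:R^-1 * (n%:R * c - s) by field; rewrite gt_eqF.
rewrite normrM ger0_norm ?invr_ge0 ?ler0n // ler_pdivrMl // -natr1.
have en : e <= e * n%:R by rewrite ler_peMr // ltW.
have := ler_norm c; have := ler_norm (- c); rewrite normrN.
rewrite !ler_norml => x1 x2 /andP[a1 a2]; apply/andP; split; lra.
Qed.

End Limit.

(** * The Euler product *)

Section Constants.
Context {R : realType} {k : nat}.
Hypothesis k2 : (2 <= k)%N.

Lemma euler_factor_ge0_le1 p : prime p -> 0 <= (1 - 2 / p%:R ^+ k : R) <= 1.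
Proof.
move=> pp; have p2 : 2 <= p%:R ^+ k :> R.
  rewrite -natrX ler_nat; apply: leq_trans (prime_gt1 pp) _.
  by rewrite -{1}(expn1 p) leq_exp2l ?prime_gt1 //; lia.
by rewrite subr_ge0 ler_pdivrMr ?mul1r ?p2 ?gerBl ?divr_ge0 ?exprn_ge0 //; lra.
Qed.

Lemma prime_prod_cvg :
  (\prod_(p < N | prime p) (1 - 2 / (p%:R ^+ k)) : R) @[N --> \oo] --> prime_prod R k.
Proof.
pose u N : R := \prod_(p < N | prime p) (1 - 2 / (p%:R ^+ k)).
have u0 N : 0 <= u N.
  by apply: prodr_ge0 => p pp; have /andP[] := euler_factor_ge0_le1 p pp.
apply: (@nonincreasing_is_cvgn _ u).
  apply/nonincreasing_seqP => N; rewrite /u (prod_ltS _ prime (fun p => 1 - 2 / p%:R ^+ k)).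
  case: ifP => [pN|_]; last by rewrite mulr1.
  by rewrite ler_piMr ?u0 //; have /andP[] := euler_factor_ge0_le1 N pN.
by exists 0 => _ [N _ <-].
Qed.

(** [K] compares the local density at [p0] in the class [a] with the Euler factor at [p0]. Once y >
    p0, that factor completes the product over the other primes. *)
Lemma avg_trunc_cvg m p0 a e0 (j : 'I_k) (K : R) : prime p0 -> m = (p0 ^ e0.+1)%N ->
  avg m (fun v => ind_sum m a v * cop p0 j v) = K * (1 - 2 / p0%:R ^+ k) ->
  forall e : R, 0 < e -> exists Y, forall y, (Y <= y)%N ->
     `|avg (modulus m p0 y) (trunc_edge m p0 a y j) - K * prime_prod R k| <= e.
Proof.
move=> pp0 mE HK e e_gt0.
have cvK : K * \prod_(p < N | prime p) (1 - 2 / (p%:R ^+ k)) @[N --> \oo] --> K * prime_prod R k.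
  by apply: cvgM; [exact: cvg_cst | exact: prime_prod_cvg].
have [Y _ hY] := (cvgrPdist_le _ _).1 cvK e e_gt0.
exists (maxn Y p0.+1) => y yy.
rewrite (avg_trunc m p0 a y j e0) // HK distrC.
have := hY y (leq_trans (leq_maxl _ _) yy); congr (`|_ - _| <= e).
have py : (p0 < y)%N := leq_trans (leq_maxr _ _) yy.
by rewrite (bigD1 (Ordinal py)) //= mulrA.
Qed.

End Constants.

Theorem theorem1p4 (R : realType) (d : measure_display) (T : measurableType d)
  (P : probability T R) (k q : nat) (A : 'I_q -> 'I_k -> R)
  (c : nat -> 'I_q) (W : nat -> T -> 'I_k) :
  (2 <= k)%N -> (1 <= q)%N ->
  (forall s j, 0 < A s j < 1) ->
  (forall s, \sum_(j < k) A s j = 1) ->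
  (forall t j, measurable [set x | W t x = j]) ->
  (forall t j, P [set x | W t x = j] = (A (c t) j)%:E) ->
  indep_steps P W ->
  (forall r a : nat, (1 <= r)%N -> (a < 2 ^ r)%N ->
     {ae P, forall x, Rbar R (fun t => W t x) (2 ^ r) a n @[n --> \oo] -->
        (2 ^ r)%:R^-1 * prime_prod R k}) /\
  (forall p1 a : nat, prime p1 -> (3 <= p1)%N -> (a < p1)%N ->
     {ae P, forall x, Rbar R (fun t => W t x) p1 a n @[n --> \oo] -->
        (if (a == 0)%N || (a == p1.-1)%N
         then ((p1 ^ k.-1)%:R - 1) / ((p1 ^ k)%:R - 2)
         else (p1 ^ k.-1)%:R / ((p1 ^ k)%:R - 2)) * prime_prod R k}).
Proof.
move=> k2 _ A01 A1 mW PW iW.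
have A_gt0 s j : 0 < A s j by have /andP[] := A01 s j.
(* The sum dominates every reciprocal, which gives a common lower bound without taking a minimum;
   the 1 makes positivity immediate. *)
pose dl : R := (1 + \sum_s \sum_j (A s j)^-1)^-1.
have sum0 : 0 <= \sum_s \sum_j (A s j)^-1.
  by apply: sumr_ge0 => s _; apply: sumr_ge0 => j _; rewrite invr_ge0 ltW.
have dl_gt0 : 0 < dl by rewrite invr_gt0 ltr_pwDl.
have A_ge t j : dl <= A (c t) j.
  rewrite -[leRHS]invrK lef_pV2 ?posrE ?invr_gt0 // ?ltr_pwDl //.
  have h1 : 0 <= \sum_(i | i != j) (A (c t) i)^-1.
    by apply: sumr_ge0 => i _; rewrite invr_ge0 ltW.
  have h2 : 0 <= \sum_(s | s != c t) \sum_i (A s i)^-1.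
    by apply: sumr_ge0 => s _; apply: sumr_ge0 => i _; rewrite invr_ge0 ltW.
  by rewrite (bigD1 (c t)) //= (bigD1 j) //=; lra.
have A_sum1 t : \sum_j A (c t) j = 1 by apply: A1.
pose j0 : 'I_k := Ordinal (ltnW k2); pose j1 : 'I_k := Ordinal k2.
have j01 : j0 != j1 by [].
have limit := ae_Rbar_cvg P (fun t => A (c t)) W dl j0 j1 mW PW iW A_sum1 dl_gt0 A_ge j01.
split=> [r a r1 _|p a pp p3 ap].
  have rE : (2 ^ r = 2 ^ r.-1.+1)%N by rewrite prednK.
  apply: (limit _ 2%N a r.-1 _ isT rE).
  apply: (avg_trunc_cvg k2 _ _ _ r.-1) => //.
  exact: avg_ind_cop2.
apply: (limit _ p a 0%N _ pp (esym (expn1 p))).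
apply: (avg_trunc_cvg k2 _ _ _ 0%N) => //; rewrite avg_ind_cop ?prime_gt1 //.
have p0 : p%:R != 0 :> R by rewrite pnatr_eq0 -lt0n prime_gt0.
have pk : p%:R ^+ k - 2 != 0 :> R.
  have : 3 <= p%:R ^+ k :> R.
    rewrite -natrX ler_nat; apply: leq_trans p3 _.
    by rewrite -{1}(expn1 p) leq_exp2l ?prime_gt1 //; lia.
  by move=> h; rewrite gt_eqF //; lra.
have kE : p%:R ^+ k = p%:R * p%:R ^+ k.-1 :> R by rewrite -exprS prednK // ltnW.
have da : (p %| a)%N = (a == 0)%N.
  by rewrite /dvdn modn_small.
have da1 : (p %| a.+1)%N = (a == p.-1)%N.
  have [->|ne] := eqVneq a p.-1; first by rewrite prednK ?prime_gt0 // dvdnn.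
  by rewrite /dvdn modn_small //; lia.
rewrite da da1 !natrX kE; rewrite kE in pk.
have pk1 : p%:R ^+ k.-1 != 0 :> R by rewrite expf_neq0.
case: (eqVneq a 0%N) => [->|_] /=; first last.
  case: (eqVneq a p.-1) => _ /=; field; by rewrite p0 pk1 pk.
rewrite (_ : (0 == p.-1)%N = false); last by lia.
by rewrite addr0; field; rewrite p0 pk1 pk.
Qed.
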